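(* Over $\mathrm{ZFCU}_{\mathrm{R}}$, the following are equivalent: (1) Collection; (2) Fullness Principle: for every forcing poset $\mathbb{P}$, its forcing relation $\Vdash$ is full, i.e. whenever $p\Vdash\exists y\,\varphi(y,\dot x_1,\dots,\dot x_n)$ for $\mathbb{P}$-names $\dot x_i$, there is a $\mathbb{P}$-name $\dot y$ with $p\Vdash\varphi(\dot y,\dot x_1,\dots,\dot x_n)$.
   Context: The language of urelement set theory has $\in$ and a predicate $\mathcal{A}$ for urelements; $\mathrm{ZFCU}_{\mathrm{R}}$ = ZU (urelements have no members, Extensionality for sets, Foundation, Pairing, Union, Powerset, Infinity, Separation scheme) + Replacement scheme + AC. Collection: for every $\varphi$, $\forall w,u(\forall x\in w\,\exists y\,\varphi\to\exists v\,\forall x\in w\,\exists y\in v\,\varphi)$. For a poset $\mathbb{P}$ with top $1_{\mathbb{P}}$: $\dot x$ is a $\mathbb{P}$-name iff $\dot x$ is a set of pairs $\langle y,p\rangle$ with $p\in\mathbb{P}$ and $y$ either a $\mathbb{P}$-name or an urelement, such that whenever $\langle a,p\rangle,\langle y,q\rangle\in\dot x$ with $a$ an urelement and $y\neq a$, $p\perp q$ (defined by recursion). The forcing language has $\subseteq,=,\in,\mathcal{A},\overset{\mathcal A}{=}$ and the $\mathbb{P}$-names as constants, and $\Vdash$ is defined by: $p\Vdash\mathcal{A}(\dot x)$ iff $\{q:\exists\langle a,r\rangle\in\dot x(\mathcal{A}(a)\wedge q\le r)\}$ is dense below $p$; $p\Vdash\dot x_1\overset{\mathcal A}{=}\dot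 x_2$ iff the union of $\{q:\exists a,r_1,r_2(\mathcal{A}(a)\wedge\langle a,r_1\rangle\in\dot x_1\wedge\langle a,r_2\rangle\in\dot x_2\wedge q\le r_1,r_2)\}$ and $\{q:$ $q\perp r$ for every $\langle a,r\rangle\in\dot x_1\cup\dot x_2$ with $\mathcal{A}(a)\}$ is dense below $p$; $p\Vdash\dot x_1\in\dot x_2$ iff $\{q:\exists\langle\dot y,r\rangle\in\dot x_2(\dot y$ a $\mathbb{P}$-name, $q\le r$, $q\Vdash\dot y=\dot x_1)\}$ is dense below $p$; $p\Vdash\dot x_1\subseteq\dot x_2$ iff for all $\mathbb{P}$-names $\dot y$ and $r,q$ with $\langle\dot y,r\rangle\in\dot x_1$ and $q\le p,r$, $q\Vdash\dot y\in\dot x_2$; $p\Vdash\dot x_1=\dot x_2$ iff $p$ forces $\dot x_1\subseteq\dot x_2$, $\dot x_2\subseteq\dot x_1$ and $\dot x_1\overset{\mathcal A}{=}\dot x_2$; $p\Vdash\neg\varphi$ iff no $q\le p$ forces $\varphi$; $p\Vdash\varphi\wedge\psi$ iff $p$ forces both; $p\Vdash\exists x\varphi$ iff $\{q:\exists$ $\mathbb{P}$-name $\dot z$ with $q\Vdash\varphi(\dot z)\}$ is dense below $p$. *)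

(* Defs.v *)
(* Stdlib only: first-order set theory with urelements, interpreted in
   arbitrary structures. *)

Set Implicit Arguments.

Record ustructure := UStructure {
  dom :> Type;
  mem : dom -> dom -> Prop;   (* [mem x y]: x is an element of y *)
  ur : dom -> Prop            (* the urelement predicate *)
}.
Arguments mem {_} _ _.
Arguments ur {_} _.

Definition scons {T : Type} (x : T) (e : nat -> T) (n : nat) : T :=
  match n with 0 => x | S k => e k end.

(** * The language of urelement set theory *)

(* De Bruijn indices: [s_ex] binds variable 0. The remaining connectives are
   the usual classical abbreviations. *)
Inductive sform : Type :=
| s_mem : nat -> nat -> sform
| s_eq : nat -> nat -> sform
| s_ur : nat -> sform
| s_not : sform -> sform
| s_and : sform -> sform -> sform
| s_ex : sform -> sform.

Fixpoint sat (M : ustructure) (phi : sform) (e : nat -> M) : Prop :=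
  match phi with
  | s_mem i j => mem (e i) (e j)
  | s_eq i j => e i = e j
  | s_ur i => ur (e i)
  | s_not f => ~ sat M f e
  | s_and f g => sat M f e /\ sat M g e
  | s_ex f => exists x : M, sat M f (scons x e)
  end.

(** * Set-theoretic vocabulary inside a structure *)

Definition is_empty {M : ustructure} (x : M) : Prop :=
  ~ ur x /\ forall z, ~ mem z x.

Definition is_upair {M : ustructure} (z x y : M) : Prop :=
  ~ ur z /\ forall v, mem v z <-> v = x \/ v = y.

(* Kuratowski pair: z = {{x}, {x, y}} *)
Definition is_pair {M : ustructure} (z x y : M) : Prop :=
  exists u v, is_upair u x x /\ is_upair v x y /\ is_upair z u v.

Definition pair_in {M : ustructure} (x y s : M) : Prop :=
  exists z, is_pair z x y /\ mem z s.

Definition triple_in {M : ustructure} (x y z s : M) : Prop :=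
  exists t, is_pair t y z /\ pair_in x t s.

Definition is_succ {M : ustructure} (s x : M) : Prop :=
  ~ ur s /\ forall v, mem v s <-> mem v x \/ v = x.

(** * The axioms *)

Definition ur_no_members (M : ustructure) : Prop :=
  forall a x : M, ur a -> ~ mem x a.

Definition extensionality (M : ustructure) : Prop :=
  forall x y : M, ~ ur x -> ~ ur y ->
    (forall z, mem z x <-> mem z y) -> x = y.

Definition foundation (M : ustructure) : Prop :=
  forall x : M, (exists y, mem y x) ->
    exists y, mem y x /\ forall z, mem z x -> ~ mem z y.

Definition pairing (M : ustructure) : Prop :=
  forall x y : M, exists z, is_upair z x y.

Definition union (M : ustructure) : Prop :=
  forall x : M, exists u, ~ ur u /\
    forall y, mem y u <-> exists z, mem z x /\ mem y z.

Definition powerset (M : ustructure) : Prop :=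
  forall x : M, exists u, ~ ur u /\
    forall y, mem y u <-> ~ ur y /\ forall z, mem z y -> mem z x.

Definition infinity (M : ustructure) : Prop :=
  exists w : M, (exists e, is_empty e /\ mem e w) /\
    forall x, mem x w -> exists s, is_succ s x /\ mem s w.

(* In the schemes, [e] supplies the parameters. *)

Definition separation (M : ustructure) : Prop :=
  forall (phi : sform) (e : nat -> M) (w : M),
    exists v, ~ ur v /\
      forall x, mem x v <-> mem x w /\ sat M phi (scons x e).

Definition replacement (M : ustructure) : Prop :=
  forall (phi : sform) (e : nat -> M) (w : M),
    (forall x, mem x w -> exists! y, sat M phi (scons y (scons x e))) ->
    exists v, ~ ur v /\
      forall y, mem y v <->
        exists x, mem x w /\ sat M phi (scons y (scons x e)).

(* every set of nonempty sets has a choice function *)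
Definition choice_axiom (M : ustructure) : Prop :=
  forall F : M, (forall x, mem x F -> exists y, mem y x) ->
    exists f, ~ ur f /\
      (forall z, mem z f -> exists x y, is_pair z x y /\ mem x F /\ mem y x) /\
      (forall x, mem x F -> exists! y, pair_in x y f).

Record ZFCU_R (M : ustructure) : Prop := {
  zfcu_ur_no_members : ur_no_members M;
  zfcu_extensionality : extensionality M;
  zfcu_foundation : foundation M;
  zfcu_pairing : pairing M;
  zfcu_union : union M;
  zfcu_powerset : powerset M;
  zfcu_infinity : infinity M;
  zfcu_separation : separation M;
  zfcu_replacement : replacement M;
  zfcu_choice : choice_axiom M
}.

Definition Collection (M : ustructure) : Prop :=
  forall (phi : sform) (e : nat -> M) (w : M),
    (forall x, mem x w -> exists y, sat M phi (scons y (scons x e))) ->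
    exists v, forall x, mem x w ->
      exists y, mem y v /\ sat M phi (scons y (scons x e)).

(** * Forcing posets *)

Record poset (M : ustructure) := Poset {
  carrier : M;
  order : M;
  top : M;
  carrier_set : ~ ur carrier;
  order_set : ~ ur order;
  order_dom : forall z, mem z order ->
    exists p q, is_pair z p q /\ mem p carrier /\ mem q carrier;
  order_refl : forall p, mem p carrier -> pair_in p p order;
  order_trans : forall p q r,
    pair_in p q order -> pair_in q r order -> pair_in p r order;
  order_antisym : forall p q,
    pair_in p q order -> pair_in q p order -> p = q;
  top_in : mem top carrier;
  top_max : forall p, mem p carrier -> pair_in p top order
}.

Definition ple {M : ustructure} (P : poset M) (p q : M) : Prop :=
  pair_in p q (order P).

Definition incompat {M : ustructure} (P : poset M) (p q : M) : Prop :=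
  ~ exists r, ple P r p /\ ple P r q.

Definition dense_below {M : ustructure} (P : poset M)
    (D : M -> Prop) (p : M) : Prop :=
  forall q, ple P q p -> exists r, ple P r q /\ D r.

(** * Names *)

(* The clause of the recursive definition of names, with "y is a name"
   replaced by "y belongs to T". *)
Definition name_clause {M : ustructure} (P : poset M) (T x : M) : Prop :=
  ~ ur x /\
  (forall z, mem z x ->
     exists y p, is_pair z y p /\ mem p (carrier P) /\ (mem y T \/ ur y)) /\
  (forall a p y q, ur a -> pair_in a p x -> pair_in y q x -> y <> a ->
     incompat P p q).

Definition name_closed {M : ustructure} (P : poset M) (T : M) : Prop :=
  forall x, mem x T -> name_clause P T x.

(* The recursion takes place inside [M], which may be ill-founded externally:
   x is a name iff some set of [M] containing x witnesses it. *)
Definition is_name {M : ustructure} (P : poset M) (x : M) : Prop :=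
  exists T, name_closed P T /\ mem x T.

(** * Forcing of atomic formulas *)

Definition forces_ur {M : ustructure} (P : poset M) (p x : M) : Prop :=
  dense_below P (fun q => exists a r, ur a /\ pair_in a r x /\ ple P q r) p.

Definition forces_ureq {M : ustructure} (P : poset M) (p x1 x2 : M) : Prop :=
  dense_below P (fun q =>
    (exists a r1 r2, ur a /\ pair_in a r1 x1 /\ pair_in a r2 x2 /\
       ple P q r1 /\ ple P q r2) \/
    (mem q (carrier P) /\
     forall a r, ur a -> pair_in a r x1 \/ pair_in a r x2 ->
       incompat P q r)) p.

(* The clauses for membership, inclusion and equality are mutually recursive.
   They are stated relative to a relation [E] standing for forced equality of
   names of lower rank. *)
Section Clauses.
Context {M : ustructure} (P : poset M) (E : M -> M -> M -> Prop).

Definition in_clause (p x1 x2 : M) : Prop :=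
  dense_below P (fun q => exists y r,
    is_name P y /\ pair_in y r x2 /\ ple P q r /\ E q y x1) p.

Definition sub_clause (p x1 x2 : M) : Prop :=
  forall y r q, is_name P y -> pair_in y r x1 -> ple P q p -> ple P q r ->
    in_clause q y x2.

Definition eq_clause (p x1 x2 : M) : Prop :=
  sub_clause p x1 x2 /\ sub_clause p x2 x1 /\ forces_ureq P p x1 x2.

End Clauses.

(* R is, on a set T of names closed under subnames, a set-sized solution of
   the recursion equation for forced equality. *)
Definition eq_attempt {M : ustructure} (P : poset M) (T R : M) : Prop :=
  name_closed P T /\
  forall p x1 x2, mem p (carrier P) -> mem x1 T -> mem x2 T ->
    (triple_in p x1 x2 R <->
     eq_clause P (fun q y1 y2 => triple_in q y1 y2 R) p x1 x2).

Definition forces_eq {M : ustructure} (P : poset M) (p x1 x2 : M) : Prop :=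
  exists T R, eq_attempt P T R /\ mem p (carrier P) /\ mem x1 T /\ mem x2 T /\
    triple_in p x1 x2 R.

Definition forces_in {M : ustructure} (P : poset M) : M -> M -> M -> Prop :=
  in_clause P (forces_eq P).

Definition forces_sub {M : ustructure} (P : poset M) : M -> M -> M -> Prop :=
  sub_clause P (forces_eq P).

(** * The forcing language and the forcing relation *)

(* Names enter a formula as the values assigned to its free variables. *)
Inductive fform : Type :=
| f_sub : nat -> nat -> fform
| f_eq : nat -> nat -> fform
| f_in : nat -> nat -> fform
| f_ur : nat -> fform
| f_ureq : nat -> nat -> fform
| f_not : fform -> fform
| f_and : fform -> fform -> fform
| f_ex : fform -> fform.

Fixpoint forces {M : ustructure} (P : poset M) (p : M) (phi : fform)
    (e : nat -> M) : Prop :=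
  match phi with
  | f_sub i j => forces_sub P p (e i) (e j)
  | f_eq i j => forces_eq P p (e i) (e j)
  | f_in i j => forces_in P p (e i) (e j)
  | f_ur i => forces_ur P p (e i)
  | f_ureq i j => forces_ureq P p (e i) (e j)
  | f_not f => forall q, ple P q p -> ~ forces P q f e
  | f_and f g => forces P p f e /\ forces P p g e
  | f_ex f => dense_below P
      (fun q => exists z, is_name P z /\ forces P q f (scons z e)) p
  end.

Definition full {M : ustructure} (P : poset M) : Prop :=
  forall (phi : fform) (e : nat -> M), (forall i, is_name P (e i)) ->
    forall p, mem p (carrier P) -> forces P p (f_ex phi) e ->
      exists y, is_name P y /\ forces P p phi (scons y e).

Definition Fullness (M : ustructure) : Prop :=
  forall P : poset M, full P.

(* Main.v *)
(* Collection gives fullness: it bounds a set of witnessing names, a maximal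
   antichain of pairs <q, x> with q forcing phi(x) is obtained from Choice, and
   the names x are mixed along it into a single name.

   Fullness gives Collection: let the elements of w be pairwise incompatible
   atoms below a top element. An atom x decides every name, so that forcing at
   x is truth in M with each y represented by its canonical name y'. If every x
   in w has a y with phi(x, y), the top forces the existence of a name y with
   phi(xdot, y), where xdot is the mixture of the names x'. A single name
   witnessing this has a value at each atom x, and by Replacement these values
   form a set.

   Forced equality is handled as a greatest fixed point: its clause is positive
   in the relation of forced equality, so reflexivity, symmetry and transitivity
   follow by coinduction, without recursion on the rank of names. *)

From Stdlib Require Import Classical IndefiniteDescription PeanoNat.
Require Import Defs.

(** * Definable classes *)

(** Urelements may form a proper class. The witnesses of least rank then need not form a set, so
    Scott's trick gives no bound, and Replacement and Choice alone cannot gather a witnessing name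
    for each condition; Collection supplies this bound. Conversely, fullness makes many choices at
    once, namely the values of one name at many incompatible conditions. The instance [x] varies
    with the condition while a forcing formula takes fixed names as parameters, which is why the
    names of all [x] are folded into one. Two constraints shape the formalization. The schemes range
    over formulas, so each class used in Separation, Replacement or an induction must be shown
    definable, the forcing relation included. And [M] may be ill-founded from outside, so recursions
    run inside [M], through sets that satisfy the recursion equation locally. Where witnesses have
    to be gathered without Collection, they are first made unique, so that Replacement applies. *)

Section Definability.
Context {M : ustructure}.

Fixpoint ren (r : nat -> nat) (f : sform) : sform :=
  match f with
  | s_mem i j => s_mem (r i) (r j)
  | s_eq i j => s_eq (r i) (r j)
  | s_ur i => s_ur (r i)
  | s_not f => s_not (ren r f)
  | s_and f g => s_and (ren r f) (ren r g)
  | s_ex f => s_ex (ren (fun n => match n with 0 => 0 | S k => S (r k) end) f)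
  end.

Lemma sat_ext f : forall e e' : nat -> M,
  (forall n, e n = e' n) -> sat M f e <-> sat M f e'.
Proof.
  induction f as [i j|i j|i|f IH|f IHf g IHg|f IH]; intros e e' H; simpl;
    rewrite ?H; try reflexivity.
  - now rewrite (IH _ _ H).
  - now rewrite (IHf _ _ H), (IHg _ _ H).
  - split; intros [x Hx]; exists x; revert Hx; apply IH; intros [|n]; simpl; auto.
Qed.

Lemma sat_ren f : forall r (e : nat -> M),
  sat M (ren r f) e <-> sat M f (fun n => e (r n)).
Proof.
  induction f as [i j|i j|i|f IH|f IHf g IHg|f IH]; intros r e; simpl;
    try reflexivity.
  - now rewrite IH.
  - now rewrite IHf, IHg.
  - split; intros [x Hx]; exists x; [apply IH in Hx | apply IH]; revert Hx;
      apply sat_ext; intros [|n]; reflexivity.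
Qed.

Definition slot (s : nat + M) (e : nat -> M) : M :=
  match s with inl i => e i | inr c => c end.

Definition is_term (t : (nat -> M) -> M) : Prop :=
  exists s, forall e, t e = slot s e.

(* First-order definability with parameters: each free variable of the formula
   stands for an argument or for a fixed element of [M]. *)
Definition definable (Q : (nat -> M) -> Prop) : Prop :=
  exists f r, forall e, Q e <-> sat M f (fun n => slot (r n) e).

(** Quantifying over terms builds closure under substitution into the notion: a definability
    hypothesis applies directly to any variables and parameters. The language has no function
    symbols, so variables and constants are all the terms. *)
Definition def1 (Q : M -> Prop) : Prop :=
  forall t, is_term t -> definable (fun e => Q (t e)).
Definition def2 (Q : M -> M -> Prop) : Prop :=
  forall t u, is_term t -> is_term u -> definable (fun e => Q (t e) (u e)).
Definition def3 (Q : M -> M -> M -> Prop) : Prop :=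
  forall t u v, is_term t -> is_term u -> is_term v ->
    definable (fun e => Q (t e) (u e) (v e)).

Lemma term_var i : is_term (fun e => e i).
Proof. now exists (inl i). Qed.

Lemma term_const c : is_term (fun _ => c).
Proof. now exists (inr c). Qed.

Lemma term_ren t (r : nat -> nat) :
  is_term t -> is_term (fun e => t (fun n => e (r n))).
Proof.
  intros [[i|c] H]; [exists (inl (r i)) | exists (inr c)]; intros e;
    now rewrite H.
Qed.

Lemma definable_iff Q Q' :
  (forall e, Q e <-> Q' e) -> definable Q' -> definable Q.
Proof.
  intros H [f [r Hf]]. exists f, r. intros e. now rewrite H.
Qed.

Lemma definable_mem t u : is_term t -> is_term u ->
  definable (fun e => mem (t e) (u e)).
Proof.
  intros [s Hs] [s' Hs'].
  exists (s_mem 0 1), (fun n => match n with 0 => s | _ => s' end).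
  intros e. simpl. now rewrite Hs, Hs'.
Qed.

Lemma definable_eq t u : is_term t -> is_term u -> definable (fun e => t e = u e).
Proof.
  intros [s Hs] [s' Hs'].
  exists (s_eq 0 1), (fun n => match n with 0 => s | _ => s' end).
  intros e. simpl. now rewrite Hs, Hs'.
Qed.

Lemma definable_ur t : is_term t -> definable (fun e => ur (t e)).
Proof.
  intros [s Hs]. exists (s_ur 0), (fun _ => s). intros e. simpl. now rewrite Hs.
Qed.

Lemma definable_not Q : definable Q -> definable (fun e => ~ Q e).
Proof.
  intros [f [r H]]. exists (s_not f), r. intros e. simpl. now rewrite H.
Qed.

Lemma definable_and Q Q' :
  definable Q -> definable Q' -> definable (fun e => Q e /\ Q' e).
Proof.
  intros [f [r H]] [f' [r' H']].
  (* Two valuations are merged into one: the variables of [f] become the even ones and those of [f']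
     the odd ones. *)
  exists (s_and (ren (fun n => 2 * n) f) (ren (fun n => S (2 * n)) f')),
    (fun n => if Nat.even n then r (Nat.div2 n) else r' (Nat.div2 n)).
  intros e. rewrite H, H'. cbn [sat]. rewrite !sat_ren.
  split; intros [A B]; split.
  - revert A. apply sat_ext. intros n. now rewrite Nat.even_even, Nat.div2_double.
  - revert B. apply sat_ext. intros n.
    rewrite Nat.div2_succ_double, Nat.even_succ.
    replace (Nat.odd (2 * n)) with false; [reflexivity|].
    unfold Nat.odd. now rewrite Nat.even_even.
  - revert A. apply sat_ext. intros n. now rewrite Nat.even_even, Nat.div2_double.
  - revert B. apply sat_ext. intros n.
    rewrite Nat.div2_succ_double, Nat.even_succ.
    replace (Nat.odd (2 * n)) with false; [reflexivity|].
    unfold Nat.odd. now rewrite Nat.even_even.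
Qed.

Lemma definable_ex (R : M -> (nat -> M) -> Prop) :
  definable (fun e => R (e 0) (fun n => e (S n))) ->
  definable (fun e => exists x, R x e).
Proof.
  intros [f [r H]].
  (* Several variables of [f] may stand for argument 0, which is to be bound. [ix] merges them into
     variable 0 and shifts the others past the binder; [r'] lowers the remaining arguments by
     one. *)
  set (ix := fun n => match r n with inl 0 => 0 | _ => S n end).
  set (r' := fun n => match r n with inl (S i) => inl i | s => s end).
  exists (s_ex (ren ix f)), r'. intros e. cbn [sat].
  assert (K : forall x,
    R x e <-> sat M (ren ix f) (scons x (fun n => slot (r' n) e))).
  { intros x. rewrite sat_ren, (H (scons x e)). apply sat_ext.
    intros n. unfold ix, r'. destruct (r n) as [[|i]|c] eqn:E; simpl; now rewrite ?E. }
  split; intros [x Hx]; exists x; now apply K.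
Qed.

Lemma definable_or Q Q' :
  definable Q -> definable Q' -> definable (fun e => Q e \/ Q' e).
Proof.
  intros H H'. apply definable_iff with (fun e => ~ (~ Q e /\ ~ Q' e)).
  - intros e. destruct (classic (Q' e)), (classic (Q e)); tauto.
  - apply definable_not, definable_and; now apply definable_not.
Qed.

Lemma definable_imp Q Q' :
  definable Q -> definable Q' -> definable (fun e => Q e -> Q' e).
Proof.
  intros H H'. apply definable_iff with (fun e => ~ (Q e /\ ~ Q' e)).
  - intros e. destruct (classic (Q' e)), (classic (Q e)); tauto.
  - apply definable_not, definable_and; auto using definable_not.
Qed.

Lemma definable_all (R : M -> (nat -> M) -> Prop) :
  definable (fun e => R (e 0) (fun n => e (S n))) ->
  definable (fun e => forall x, R x e).
Proof.
  intros H. apply definable_iff with (fun e => ~ exists x, ~ R x e).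
  - intros e. split.
    + intros A [x B]. auto.
    + intros A x. apply NNPP. intros B. eauto.
  - apply definable_not, definable_ex. now apply definable_not.
Qed.

(** This is the form required by the axiom schemes, where parameters are an ordinary valuation; [c0]
    is the default value beyond the two arguments. *)
Lemma def2_sat (c0 : M) (Q : M -> M -> Prop) : def2 Q ->
  exists f e, forall x y, Q x y <-> sat M f (scons y (scons x e)).
Proof.
  intros HQ.
  destruct (HQ _ _ (term_var 1) (term_var 0)) as [f [r H]].
  exists (ren (fun n => match r n with inl 0 => 0 | inl 1 => 1 | _ => S (S n) end) f),
    (fun n => match r n with inr c => c | _ => c0 end).
  intros x y. rewrite sat_ren.
  rewrite (H (scons y (scons x (fun _ => c0)))).
  apply sat_ext. intros n.
  destruct (r n) as [[|[|i]]|c] eqn:E; simpl; now rewrite ?E.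
Qed.

End Definability.

Ltac dterm :=
  first [ assumption | apply term_var | apply term_const
        | apply term_ren; dterm ].
(** Reassigned by [::=] whenever further notions have been shown definable, so that [dfn] stops at
    them instead of unfolding them. *)
Ltac dfn_hint := fail.
Ltac dfn :=
  cbn beta;
  lazymatch goal with
  | |- is_term _ => dterm
  | |- def1 _ => intros ? ?; dfn
  | |- def2 _ => intros ? ? ? ?; dfn
  | |- def3 _ => intros ? ? ? ? ? ?; dfn
  | |- definable _ =>
    first [ match goal with
            | H : def1 _ |- _ => apply H; dfn
            | H : def2 _ |- _ => apply H; dfn
            | H : def3 _ |- _ => apply H; dfn
            end
          | dfn_hint; dfn
          | apply definable_mem; dfn | apply definable_eq; dfn
          | apply definable_ur; dfn | apply definable_not; dfn
          | apply definable_and; dfn | apply definable_or; dfn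
          | apply definable_ex; dfn | apply definable_all; dfn
          | apply definable_imp; dfn ]
  | |- _ => assumption
  end.

(** * Set theory inside the structure *)

Section Vocabulary.
Context {M : ustructure}.

Definition is_union (u x : M) : Prop :=
  ~ ur u /\ forall y, mem y u <-> exists z, mem z x /\ mem y z.

Lemma definable_is_pair : def3 (@is_pair M).
Proof. dfn. Qed.

Lemma definable_pair_in : def3 (@pair_in M).
Proof. dfn. Qed.

Lemma definable_is_union : def2 is_union.
Proof. dfn. Qed.

Lemma definable_is_succ : def2 (@is_succ M).
Proof. dfn. Qed.

End Vocabulary.

Ltac dfn_set :=
  first [ apply definable_is_pair | apply definable_pair_in
        | apply definable_is_union | apply definable_is_succ ].
Ltac dfn_hint ::= dfn_set.

Section SetTheory.
Context {M : ustructure}.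
Hypothesis HM : ZFCU_R M.

Lemma not_ur_mem (a x : M) : mem x a -> ~ ur a.
Proof. intros H Ha. exact (zfcu_ur_no_members HM a x Ha H). Qed.

Lemma set_ext (x y : M) : ~ ur x -> ~ ur y ->
  (forall z, mem z x <-> mem z y) -> x = y.
Proof. apply (zfcu_extensionality HM). Qed.

Lemma sep (Q : M -> Prop) w : def1 Q ->
  exists v, ~ ur v /\ forall x, mem x v <-> mem x w /\ Q x.
Proof.
  intros HQ.
  assert (H2 : def2 (fun _ x => Q x)) by dfn.
  destruct (def2_sat w _ H2) as [f [e H]].
  destruct (zfcu_separation HM f (scons w e) w) as [v [Hv K]].
  exists v. split; [exact Hv|]. intros x. rewrite K, (H w x). reflexivity.
Qed.

(** The axiom asks for a total functional relation. Restricting [w] to the domain of [Q] by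
    Separation allows [Q] to be partial. *)
Lemma repl (Q : M -> M -> Prop) w : def2 Q ->
  (forall x y y', mem x w -> Q x y -> Q x y' -> y = y') ->
  exists v, ~ ur v /\ forall y, mem y v <-> exists x, mem x w /\ Q x y.
Proof.
  intros HQ Hf.
  destruct (sep (fun x => exists y, Q x y) w) as [w' [_ Hw']]; [dfn|].
  destruct (def2_sat w _ HQ) as [f [e H]].
  destruct (zfcu_replacement HM f e w') as [v [Hv K]].
  - intros x Hx. apply Hw' in Hx as [Hx [y Hy]].
    exists y. split; [now apply H|]. intros y' Hy'. apply H in Hy'. eauto.
  - exists v. split; [exact Hv|]. intros y. rewrite K. split.
    + intros [x [Hx Hy]]. exists x. apply Hw' in Hx. apply H in Hy. tauto.
    + intros [x [Hx Hy]]. exists x. split; [|now apply H].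
      apply Hw'. eauto.
Qed.

Lemma singleton_ex (x : M) : exists u, ~ ur u /\ forall z, mem z u <-> z = x.
Proof.
  destruct (zfcu_pairing HM x x) as [u [Hu K]]. exists u. split; [exact Hu|].
  intros z. rewrite K. tauto.
Qed.

Lemma union_ex (x : M) : exists u, is_union u x.
Proof. apply (zfcu_union HM). Qed.

Lemma binunion_ex (a b : M) :
  exists u, ~ ur u /\ forall z, mem z u <-> mem z a \/ mem z b.
Proof.
  destruct (zfcu_pairing HM a b) as [c [_ Hc]].
  destruct (union_ex c) as [u [Hu K]]. exists u. split; [exact Hu|].
  intros z. rewrite K. split.
  - intros [t [Ht Hz]]. apply Hc in Ht as [->| ->]; tauto.
  - intros [Hz|Hz]; [exists a | exists b]; rewrite Hc; tauto.
Qed.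

Lemma adjoin_ex (a x : M) :
  exists u, ~ ur u /\ forall z, mem z u <-> mem z a \/ z = x.
Proof.
  destruct (singleton_ex x) as [s [_ Hs]].
  destruct (binunion_ex a s) as [u [Hu K]]. exists u. split; [exact Hu|].
  intros z. rewrite K, Hs. reflexivity.
Qed.

Lemma upair_uniq (z z' x y : M) : is_upair z x y -> is_upair z' x y -> z = z'.
Proof.
  intros [H K] [H' K']. apply set_ext; auto. intros v. now rewrite K, K'.
Qed.

Lemma pair_ex (x y : M) : exists z, is_pair z x y.
Proof.
  destruct (zfcu_pairing HM x x) as [u Hu].
  destruct (zfcu_pairing HM x y) as [v Hv].
  destruct (zfcu_pairing HM u v) as [z Hz].
  now exists z, u, v.
Qed.

Lemma pair_uniq (z z' x y : M) : is_pair z x y -> is_pair z' x y -> z = z'.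
Proof.
  intros (u & v & Hu & Hv & Hz) (u' & v' & Hu' & Hv' & Hz').
  rewrite (upair_uniq _ _ _ _ Hu' Hu), (upair_uniq _ _ _ _ Hv' Hv) in Hz'.
  exact (upair_uniq _ _ _ _ Hz Hz').
Qed.

Lemma pair_inj (z x y x' y' : M) :
  is_pair z x y -> is_pair z x' y' -> x = x' /\ y = y'.
Proof.
  intros (u & v & [_ Hu] & [_ Hv] & [_ Hz]) (u' & v' & [_ Hu'] & [_ Hv'] & [_ Hz']).
  assert (Ex : x = x').
  { assert (H : mem u z) by (apply Hz; tauto).
    apply Hz' in H as [->| ->].
    - assert (H : mem x u') by (apply Hu; tauto). apply Hu' in H. tauto.
    - assert (H : mem x' v') by (apply Hv'; tauto). apply Hu in H.
      destruct H; now subst. }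
  subst x'. split; [reflexivity|].
  assert (H1 : y = x \/ y = y').
  { assert (H : mem v z) by (apply Hz; tauto).
    assert (K : mem y v) by (apply Hv; tauto).
    apply Hz' in H as [->| ->]; [apply Hu' in K | apply Hv' in K]; tauto. }
  assert (H2 : y' = x \/ y' = y).
  { assert (H : mem v' z) by (apply Hz'; tauto).
    assert (K : mem y' v') by (apply Hv'; tauto).
    apply Hz in H as [->| ->]; [apply Hu in K | apply Hv in K]; tauto. }
  destruct H1, H2; congruence.
Qed.

Lemma pair_in_iff (z x y s : M) : is_pair z x y -> (pair_in x y s <-> mem z s).
Proof.
  intros H. split.
  - intros [z' [H' K]]. now rewrite (pair_uniq _ _ _ _ H H').
  - intros K. now exists z.
Qed.

Lemma pair_fst_mem (z x y : M) : is_pair z x y -> exists u, mem u z /\ mem x u.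
Proof.
  intros (u & v & [_ Hu] & _ & [_ Hz]). exists u. rewrite Hz, Hu. tauto.
Qed.

Lemma pair_snd_mem (z x y : M) : is_pair z x y -> exists u, mem u z /\ mem y u.
Proof.
  intros (u & v & _ & [_ Hv] & [_ Hz]). exists v. rewrite Hz, Hv. tauto.
Qed.

Lemma union2_ex (s : M) : exists u, ~ ur u /\
  forall x, mem x u <-> exists z v, mem z s /\ mem v z /\ mem x v.
Proof.
  destruct (union_ex s) as [u [_ Hu]]. destruct (union_ex u) as [v [Hv K]].
  exists v. split; [exact Hv|]. intros x. rewrite K. split.
  - intros [t [Ht Hx]]. apply Hu in Ht as [z Hz]. exists z, t. tauto.
  - intros (z & t & H). exists t. rewrite Hu. split; [exists z|]; tauto.
Qed.

(** Kuratowski pairs with components in [a] and [b] belong to the double powerset of the union of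
    the two, so Separation suffices. *)
Lemma relset (Q : M -> M -> Prop) a b : def2 Q ->
  exists s, ~ ur s /\
    (forall z, mem z s -> exists x y, is_pair z x y /\ mem x a /\ mem y b /\ Q x y) /\
    forall x y, pair_in x y s <-> mem x a /\ mem y b /\ Q x y.
Proof.
  intros HQ.
  destruct (binunion_ex a b) as [c [_ Hc]].
  destruct (zfcu_powerset HM c) as [c1 [_ Hc1]].
  destruct (zfcu_powerset HM c1) as [c2 [_ Hc2]].
  destruct (sep (fun z => exists x y, is_pair z x y /\ mem x a /\ mem y b /\ Q x y) c2)
    as [s [Hs K]]; [dfn|].
  exists s. split; [exact Hs|]. split.
  - intros z Hz. now apply K.
  - intros x y. split.
    + intros [z [Hz H]]. apply K in H as [_ (x' & y' & H & H')].
      destruct (pair_inj _ _ _ _ _ H Hz) as [-> ->]. tauto.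
    + intros (Hx & Hy & HQxy). destruct (pair_ex x y) as [z Hz].
      exists z. split; [exact Hz|]. apply K. split; [|exists x, y; tauto].
      destruct Hz as (u & v & [Hu Ku] & [Hv Kv] & [Hz Kz]).
      apply Hc2. split; [exact Hz|]. intros t Ht. apply Kz in Ht.
      apply Hc1. destruct Ht as [->| ->].
      * split; [exact Hu|]. intros t Ht. apply Ku in Ht. apply Hc.
        destruct Ht as [->| ->]; tauto.
      * split; [exact Hv|]. intros t Ht. apply Kv in Ht. apply Hc.
        destruct Ht as [->| ->]; tauto.
Qed.

Lemma graph_ex (Q : M -> M -> Prop) w : def2 Q ->
  (forall x y y', mem x w -> Q x y -> Q x y' -> y = y') ->
  exists g, ~ ur g /\ forall x y, pair_in x y g <-> mem x w /\ Q x y.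
Proof.
  intros HQ Hf. destruct (repl Q w HQ Hf) as [b [_ Hb]].
  destruct (relset Q w b HQ) as (g & Hg & _ & K). exists g. split; [exact Hg|].
  intros x y. rewrite K, Hb. split; [tauto|].
  intros [Hx Hy]. split; [|split]; eauto.
Qed.

Lemma adjoin_pair_ex (g x y : M) : exists g', ~ ur g' /\
  forall u v, pair_in u v g' <-> pair_in u v g \/ u = x /\ v = y.
Proof.
  destruct (pair_ex x y) as [z Hz]. destruct (adjoin_ex g z) as [g' [Hg' K]].
  exists g'. split; [exact Hg'|]. intros u v.
  destruct (pair_ex u v) as [t Ht].
  rewrite (pair_in_iff _ _ _ g' Ht), (pair_in_iff _ _ _ g Ht), K.
  split; (intros [H|H]; [tauto|right]).
  - subst t. destruct (pair_inj _ _ _ _ _ Ht Hz). tauto.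
  - destruct H as [-> ->]. exact (pair_uniq _ _ _ _ Ht Hz).
Qed.

Lemma mem_irrefl (x : M) : ~ mem x x.
Proof.
  intros H. destruct (singleton_ex x) as [s [_ Hs]].
  destruct (zfcu_foundation HM s) as [y [Hy K]].
  - exists x. now apply Hs.
  - apply Hs in Hy. subst y. apply (K x); [now apply Hs | exact H].
Qed.

Lemma mem_asym (x y : M) : mem x y -> ~ mem y x.
Proof.
  intros H H'. destruct (zfcu_pairing HM x y) as [s [_ Hs]].
  destruct (zfcu_foundation HM s) as [z [Hz K]].
  - exists x. apply Hs. tauto.
  - apply Hs in Hz as [->| ->].
    + apply (K y); [apply Hs; tauto | exact H'].
    + apply (K x); [apply Hs; tauto | exact H].
Qed.

Lemma succ_inj (s x y : M) : is_succ s x -> is_succ s y -> x = y.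
Proof.
  intros [_ H] [_ K].
  assert (Hx : mem x s) by (apply H; tauto).
  assert (Hy : mem y s) by (apply K; tauto).
  apply K in Hx as [Hx|Hx]; [|exact Hx].
  apply H in Hy as [Hy|Hy]; [|now symmetry].
  destruct (mem_asym _ _ Hx Hy).
Qed.

(** [N] is the intersection of all inductive sets, cut out of one of them. Induction holds only for
    definable properties, as [N] may have nonstandard elements seen from outside. *)
Lemma omega_ex : exists N : M,
  (exists o, is_empty o /\ mem o N) /\
  (forall x, mem x N -> exists s, is_succ s x /\ mem s N) /\
  forall Q, def1 Q -> (forall o, is_empty o -> Q o) ->
    (forall x s, mem x N -> is_succ s x -> Q x -> Q s) ->
    forall x, mem x N -> Q x.
Proof.
  destruct (zfcu_infinity HM) as [w [[o [Ho How]] Hw]].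
  set (ind := fun I : M => (forall o, is_empty o -> mem o I) /\
    forall x s, mem x I -> is_succ s x -> mem s I).
  assert (Hind : def1 ind) by (unfold ind; dfn).
  assert (Hww : ind w).
  { split.
    - intros o' [Ho' K']. destruct Ho as [Ho K].
      replace o' with o; [exact How|]. apply set_ext; auto.
      intros z. specialize (K z). specialize (K' z). tauto.
    - intros x s Hx [Hs Ks]. destruct (Hw x Hx) as [s' [[Hs' Ks'] H]].
      replace s with s'; [exact H|]. apply set_ext; auto.
      intros z. now rewrite Ks, Ks'. }
  destruct (sep (fun n => forall I, ind I -> mem n I) w) as [N [_ HN]]; [dfn|].
  exists N. split; [|split].
  - exists o. split; [exact Ho|]. apply HN. split; [exact How|].
    intros I [H _]. auto.
  - intros x Hx. apply HN in Hx as [Hx K].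
    destruct (Hw x Hx) as [s [Hs Hsw]]. exists s. split; [exact Hs|].
    apply HN. split; [exact Hsw|]. intros I HI. destruct HI as [HI HI'].
    apply (HI' x); [apply K; split; assumption | exact Hs].
  - intros Q HQ H0 HS x Hx.
    destruct (sep Q N HQ) as [S [_ KS]].
    enough (mem x S) by (now apply KS).
    apply HN in Hx as [_ Hx]. apply Hx. split.
    + intros o' Ho'. apply KS. split; [|auto]. apply HN.
      split; [now apply Hww | intros I [HI _]; auto].
    + intros y s Hy Hs. apply KS in Hy as [Hy Qy]. apply KS.
      split; [|now apply (HS y)]. apply HN in Hy as [Hy K]. apply HN.
      split; [now apply (proj2 Hww y)|]. intros I HI.
      apply (proj2 HI y); auto.
Qed.

(** Unions are iterated along the natural numbers, starting from the singleton of [x], and the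
    values collected. An attempt at this recursion is a set of pairs each of which is justified by
    the recursion equation within the set. *)
Lemma transitive_closure_ex (x : M) :
  exists T, mem x T /\ forall t z, mem t T -> mem z t -> mem z T.
Proof.
  destruct omega_ex as (N & [o [Ho HoN]] & HS & Hind).
  destruct (singleton_ex x) as [x0 [_ Hx0]].
  set (att := fun g : M => forall n y, pair_in n y g ->
    is_empty n /\ y = x0 \/
    exists m z, is_succ n m /\ pair_in m z g /\ is_union y z).
  set (H := fun n y => exists g, att g /\ pair_in n y g).
  assert (Hfun : forall n, mem n N -> forall y y', H n y -> H n y' -> y = y').
  { apply (Hind (fun n => forall y y', H n y -> H n y' -> y = y')).
    - unfold H, att. dfn.
    - intros n [_ Hn] y y' [g [Hg K]] [g' [Hg' K']].
      destruct (Hg _ _ K) as [[_ ->]|(m & z & [_ Hm] & _)].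
      2:{ destruct (Hn m). apply Hm. tauto. }
      destruct (Hg' _ _ K') as [[_ ->]|(m & z & [_ Hm] & _)]; [reflexivity|].
      destruct (Hn m). apply Hm. tauto.
    - intros n s Hn Hs IH y y' [g [Hg K]] [g' [Hg' K']].
      destruct (Hg _ _ K) as [[[_ He] _]|(m & z & Hm & Hz & Hy)].
      { destruct (He n). apply Hs. tauto. }
      destruct (Hg' _ _ K') as [[[_ He] _]|(m' & z' & Hm' & Hz' & Hy')].
      { destruct (He n). apply Hs. tauto. }
      rewrite (succ_inj _ _ _ Hm Hs) in Hz. rewrite (succ_inj _ _ _ Hm' Hs) in Hz'.
      assert (E : z = z') by (apply IH; [exists g | exists g']; auto).
      subst z'. destruct Hy as [Hy Ky], Hy' as [Hy' Ky'].
      apply set_ext; auto. intros v. now rewrite Ky, Ky'. }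
  destruct (repl H N) as [v [_ Hv]].
  { unfold H, att. dfn. }
  { intros n y y' Hn. now apply Hfun. }
  destruct (union_ex v) as [T [_ HT]]. exists T. split.
  - apply HT. exists x0. split; [|now apply Hx0]. apply Hv. exists o.
    (* The first [o] is the empty attempt, the second is the number zero. *)
    split; [exact HoN|]. destruct (adjoin_pair_ex o o x0) as [g [_ Hg]].
    exists g. split; [|apply Hg; tauto]. intros n y K. left.
    apply Hg in K as [[p [_ K]]|[-> ->]]; [destruct (proj2 Ho _ K) | tauto].
  - intros t z Ht Hz. apply HT in Ht as [y [Hy Ht]].
    apply Hv in Hy as [n [Hn [g [Hg K]]]].
    destruct (HS n Hn) as [s [Hs HsN]]. destruct (union_ex y) as [y' Hy'].
    apply HT. exists y'. split; [|apply Hy'; eauto].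
    apply Hv. exists s. split; [exact HsN|].
    destruct (adjoin_pair_ex g s y') as [g' [_ Hg']]. exists g'.
    split; [|apply Hg'; tauto]. intros n' u Hu.
    apply Hg' in Hu as [Hu|[-> ->]].
    + destruct (Hg _ _ Hu) as [A|(m & c & A & B & C)]; [tauto|].
      right. exists m, c. rewrite Hg'. tauto.
    + right. exists n, y. rewrite Hg'. tauto.
Qed.

(** Foundation speaks of sets only; the counterexamples inside a transitive set containing [x] do
    form a set. *)
Lemma mem_ind (Q : M -> Prop) : def1 Q ->
  (forall x, (forall y, mem y x -> Q y) -> Q x) -> forall x, Q x.
Proof.
  intros HQ IH x. apply NNPP. intros Hx.
  destruct (transitive_closure_ex x) as [T [HxT HT]].
  destruct (sep (fun t => ~ Q t) T) as [S [_ HS]]; [dfn|].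
  destruct (zfcu_foundation HM S) as [t [Ht K]].
  - exists x. now apply HS.
  - apply HS in Ht as [Ht Hn]. apply Hn, IH. intros y Hy. apply NNPP.
    intros Hn'. apply (K y); [|exact Hy]. apply HS. eauto.
Qed.

End SetTheory.

(** * Maximal cliques from Choice *)

Section Cliques.
Context {M : ustructure}.
Hypothesis HM : ZFCU_R M.

(* Zermelo's argument: iterate "add a chosen compatible point" from the empty
   set, taking unions, and stop when no point can be added. The stages of the
   iteration are the smallest family closed under both operations, and any two
   of them are comparable. *)
Lemma maximal_clique (R : M -> M -> Prop) W : def2 R ->
  (forall a b, R a b -> R b a) ->
  exists A, (forall a, mem a A -> mem a W) /\
    (forall a b, mem a A -> mem b A -> a = b \/ R a b) /\
    forall c, mem c W -> exists a, mem a A /\ (a = c \/ ~ R a c).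
Proof.
  intros HR Rsym.
  destruct (zfcu_powerset HM W) as [PW [_ HPW]].
  destruct (sep HM (fun X => exists y, mem y X) PW) as [F [_ HF]]; [dfn|].
  destruct (zfcu_choice HM F) as (f & _ & Hf & Hff).
  { intros X HX. now apply HF. }
  set (ext := fun A c => mem c W /\ ~ mem c A /\ forall a, mem a A -> R a c).
  (* The choice function is applied to the set of all points that extend [A]; there is no value
     exactly when no point does. *)
  set (pick := fun A z => exists X, ~ ur X /\ (forall c, mem c X <-> ext A c) /\
    pair_in X z f).
  assert (Dpick : def2 pick) by (unfold pick, ext; dfn).
  assert (pick_ext : forall A z, pick A z -> ext A z).
  { intros A z (X & _ & HX & H). apply HX. destruct H as [p [Hp H]].
    apply Hf in H as (X' & y & Hp' & _ & H).
    now destruct (pair_inj _ _ _ _ _ Hp Hp') as [-> ->]. }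
  assert (pick_uniq : forall A z z', pick A z -> pick A z' -> z = z').
  { intros A z z' (X & HuX & HX & H) (X' & HuX' & HX' & H').
    assert (X' = X).
    { apply (set_ext HM); auto. intros c. now rewrite HX, HX'. }
    subst X'. destruct (Hff X) as [y [_ Hy]].
    - destruct H as [p [Hp H]]. apply Hf in H as (X' & y & Hp' & HX'F & _).
      now destruct (pair_inj _ _ _ _ _ Hp Hp') as [-> _].
    - now rewrite <- (Hy _ H), <- (Hy _ H'). }
  assert (pick_ex : forall A c, ext A c -> exists z, pick A z).
  { intros A c Hc. destruct (sep HM (ext A) W) as [X [HuX HX]].
    { unfold ext. dfn. }
    assert (HX' : forall c, mem c X <-> ext A c).
    { intros d. rewrite HX. unfold ext. tauto. }
    destruct (Hff X) as [z [Hz _]].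
    - apply HF. split; [|exists c; now apply HX']. apply HPW.
      split; [exact HuX|]. intros d Hd. now apply HX in Hd.
    - exists z, X. auto. }
  set (next := fun A B => ~ ur B /\ forall z, mem z B <-> mem z A \/ pick A z).
  assert (next_ex : forall A, exists B, next A B).
  { intros A. destruct (binunion_ex HM A W) as [U [_ HU]].
    destruct (sep HM (fun z => mem z A \/ pick A z) U) as [B [HB K]]; [dfn|].
    exists B. split; [exact HB|]. intros z. rewrite K, HU. split; [tauto|].
    intros [H|H]; [tauto|]. destruct (pick_ext _ _ H). tauto. }
  (* The empty stage enters as the union of an empty family. *)
  set (tower := fun T => (forall A B, mem A T -> next A B -> mem B T) /\
    (forall S U, (forall s, mem s S -> mem s T) -> is_union U S -> mem U T)).
  assert (Dtower : def1 tower) by (unfold tower, next; dfn).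
  destruct (sep HM (fun A => forall T, tower T -> mem A T) PW) as [C [_ HC]];
    [dfn|].
  assert (HPWt : tower PW).
  { split.
    - intros A B HA [HB K]. apply HPW in HA as [_ HA]. apply HPW.
      split; [exact HB|]. intros z Hz. apply K in Hz as [Hz|Hz]; [auto|].
      exact (proj1 (pick_ext _ _ Hz)).
    - intros S U HS [HU K]. apply HPW. split; [exact HU|]. intros z Hz.
      apply K in Hz as [s [Hs Hz]]. apply HS, HPW in Hs. now apply Hs. }
  assert (HCt : tower C).
  { split.
    - intros A B HA HAB. apply HC in HA as [HA K]. apply HC. split.
      + now apply (proj1 HPWt A).
      + intros T HT. apply (proj1 HT A); auto.
    - intros S U HS HU. apply HC. split.
      + apply (proj2 HPWt S); auto. intros s Hs. apply HS, HC in Hs. tauto.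
      + intros T HT. apply (proj2 HT S); auto. intros s Hs.
        apply HS, HC in Hs. now apply Hs. }
  assert (Cur : forall A, mem A C -> ~ ur A).
  { intros A HA. apply HC in HA as [HA _]. now apply HPW in HA. }
  assert (Cind : forall Q : M -> Prop, def1 Q ->
    (forall A B, mem A C -> Q A -> next A B -> Q B) ->
    (forall S U, (forall s, mem s S -> mem s C /\ Q s) -> is_union U S -> Q U) ->
    forall A, mem A C -> Q A).
  { intros Q HQ Hn HU A HA. destruct (sep HM Q C HQ) as [T [_ HT]].
    enough (mem A T) by (now apply HT).
    apply HC in HA as [_ HA]. apply HA. split.
    - intros B B' HB HBB'. apply HT in HB as [HB QB]. apply HT.
      split; [now apply (proj1 HCt B) | now apply (Hn B)].
    - intros S U HS HSU. apply HT. split.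
      + apply (proj2 HCt S); auto. intros s Hs. apply HS, HT in Hs. tauto.
      + apply (HU S); auto. intros s Hs. apply HS, HT in Hs. tauto. }
  set (sub := fun A B => forall z : M, mem z A -> mem z B).
  assert (chain : forall A, mem A C -> forall B, mem B C -> sub B A \/ sub A B).
  { apply (Cind (fun A => forall B, mem B C -> sub B A \/ sub A B)).
    - unfold sub. dfn.
    - intros A A' HA Hcmp [HuA' HA'].
      (* Nothing lies strictly between [A] and its successor [A']: a stage is contained in [A] or
         contains [A']. *)
      enough (H : forall B, mem B C -> sub B A \/ sub A' B).
      { intros B HB. destruct (H B HB) as [K|K]; [left|tauto].
        intros z Hz. apply HA'. auto. }
      apply (Cind (fun B => sub B A \/ sub A' B)).
      + unfold sub. dfn.
      + intros B B' HB [K|K] HBB'.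
        2:{ right. intros z Hz. apply HBB'. auto. }
        destruct (Hcmp B') as [H|H]; [now apply (proj1 HCt B)|tauto|].
        destruct (classic (sub A B)) as [H'|H'].
        * right. assert (B = A).
          { apply (set_ext HM); auto. intros z. split; auto. }
          subst B. intros z Hz. apply HBB'. now apply HA'.
        (* If the new point [z] were outside [A], every element of [A] would already lie in [B]. *)
        * left. intros z Hz. apply HBB' in Hz as [Hz|Hz]; [auto|].
          apply NNPP. intros Hn. apply H'. intros t Ht.
          destruct (proj1 (proj2 HBB' t) (H t Ht)) as [G|G]; [exact G|].
          rewrite (pick_uniq _ _ _ G Hz) in Ht. contradiction.
      + intros S U HS HU.
        destruct (classic (exists s, mem s S /\ sub A' s)) as [[s [Hs K]]|Hn].
        * right. intros z Hz. apply HU. eauto.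
        * left. intros z Hz. apply HU in Hz as [s [Hs Hz]].
          destruct (HS s Hs) as [_ [H|H]]; [auto | destruct Hn; eauto].
    - intros S U HS HU B HB.
      destruct (classic (exists s, mem s S /\ sub B s)) as [[s [Hs K]]|Hn].
      + left. intros z Hz. apply HU. eauto.
      + right. intros z Hz. apply HU in Hz as [s [Hs Hz]].
        destruct (HS s Hs) as [_ H].
        destruct (H B HB) as [K|K]; [destruct Hn; eauto | auto]. }
  (* The union of all stages is itself a stage, the largest one. A point that could still be added
     would give a successor stage contained in it, so the picked point would already belong to it,
     against [ext]. *)
  destruct (union_ex HM C) as [A HA].
  assert (HAC : mem A C) by (apply (proj2 HCt C); auto).
  exists A. split; [|split].
  - intros a Ha. apply HC in HAC as [H _]. apply HPW in H. now apply H.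
  - revert A HA HAC. enough (H : forall A, mem A C ->
      forall a b, mem a A -> mem b A -> a = b \/ R a b) by (intros A _; apply H).
    apply (Cind (fun A => forall a b, mem a A -> mem b A -> a = b \/ R a b)).
    + dfn.
    + intros A B _ HA [_ HB] a b Ha Hb.
      apply HB in Ha as [Ha|Ha]; apply HB in Hb as [Hb|Hb].
      * auto.
      * right. now apply pick_ext in Hb as (_ & _ & Hb); apply Hb.
      * right. apply Rsym. apply pick_ext in Ha as (_ & _ & Ha). auto.
      * left. exact (pick_uniq _ _ _ Ha Hb).
    + intros S U HS HU a b Ha Hb.
      apply HU in Ha as [s [Hs Ha]]. apply HU in Hb as [t [Ht Hb]].
      destruct (HS s Hs) as [HsC Qs], (HS t Ht) as [HtC Qt].
      destruct (chain s HsC t HtC) as [H|H]; auto.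
  - intros c Hc. apply NNPP. intros Hn.
    destruct (pick_ex A c) as [z Hz].
    { split; [exact Hc|]. split.
      - intros H. apply Hn. exists c. tauto.
      - intros a Ha. apply NNPP. intros H. apply Hn. eauto. }
    destruct (next_ex A) as [B HB].
    assert (HBC : mem B C) by (now apply (proj1 HCt A)).
    apply (pick_ext _ _ Hz). apply HA. exists B. split; [exact HBC|].
    apply HB. tauto.
Qed.

End Cliques.

(** * Names *)

Section NamesDef.
Context {M : ustructure} (P : poset M).

(** Being unique, this set can be gathered by Replacement; gathering arbitrary closed sets that
    witness being a name would call for Collection. *)
Definition least_closed (x T : M) : Prop :=
  ~ ur T /\ forall w, mem w T <-> forall T', name_closed P T' -> mem x T' -> mem w T'.

Lemma definable_triple_in t u v w : is_term t -> is_term u -> is_term v -> is_term w ->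
  definable (fun e => @triple_in M (t e) (u e) (v e) (w e)).
Proof. intros. dfn. Qed.

Lemma definable_is_name : def1 (is_name P).
Proof. dfn. Qed.

Lemma definable_ple : def2 (ple P).
Proof. dfn. Qed.

Lemma definable_incompat : def2 (incompat P).
Proof. dfn. Qed.

Lemma definable_least_closed : def2 least_closed.
Proof. dfn. Qed.

End NamesDef.

Ltac dfn_names :=
  first [ dfn_set | apply definable_triple_in
        | apply definable_is_name | apply definable_ple
        | apply definable_incompat | apply definable_least_closed ].
Ltac dfn_hint ::= dfn_names.

Section Names.
Context {M : ustructure} (P : poset M).
Hypothesis HM : ZFCU_R M.

Lemma ple_carrier p q : ple P p q -> mem p (carrier P) /\ mem q (carrier P).
Proof.
  intros [z [Hz H]]. destruct (order_dom P z H) as (p' & q' & H' & K).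
  now destruct (pair_inj _ _ _ _ _ Hz H') as [-> ->].
Qed.

Lemma ple_refl p : mem p (carrier P) -> ple P p p.
Proof. apply order_refl. Qed.

Lemma ple_refl_l p q : ple P p q -> ple P p p.
Proof. intros H. apply ple_refl. apply (ple_carrier _ _ H). Qed.

Lemma ple_trans p q r : ple P p q -> ple P q r -> ple P p r.
Proof. apply order_trans. Qed.

Lemma incompat_le p q r : ple P r p -> incompat P p q -> incompat P r q.
Proof.
  intros H K [s [Hs Hs']]. apply K. exists s. split; [|exact Hs'].
  now apply ple_trans with r.
Qed.

Lemma incompat_sym p q : incompat P p q -> incompat P q p.
Proof. intros K [s [Hs Hs']]. apply K. eauto. Qed.

Lemma not_incompat p q : ~ incompat P p q -> exists r, ple P r p /\ ple P r q.
Proof. apply NNPP. Qed.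

Lemma dense_below_impl (D D' : M -> Prop) p : (forall q, D q -> D' q) ->
  dense_below P D p -> dense_below P D' p.
Proof. intros H K q Hq. destruct (K q Hq) as [r [Hr HD]]. eauto. Qed.

Lemma dense_below_le D p q : ple P q p -> dense_below P D p -> dense_below P D q.
Proof. intros H K r Hr. apply K. now apply ple_trans with q. Qed.

Lemma dense_below_dense D p :
  dense_below P (fun q => dense_below P D q) p -> dense_below P D p.
Proof.
  intros K q Hq. destruct (K q Hq) as [r [Hr H]].
  destruct (H r (ple_refl_l _ _ Hr)) as [s [Hs HD]].
  exists s. split; [now apply ple_trans with r | exact HD].
Qed.

Lemma dense_below_all (D : M -> Prop) p :
  (forall q, ple P q p -> D q) -> dense_below P D p.
Proof. intros H q Hq. exists q. split; [exact (ple_refl_l _ _ Hq) | auto]. Qed.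

Lemma name_clause_mono (T T' x : M) : (forall y, mem y T -> mem y T') ->
  name_clause P T x -> name_clause P T' x.
Proof.
  intros H (Hx & K & L). split; [exact Hx|]. split; [|exact L].
  intros z Hz. destruct (K z Hz) as (y & p & A & B & C). exists y, p.
  split; [exact A|]. split; [exact B|]. destruct C; auto.
Qed.

Lemma name_elim x : is_name P x -> ~ ur x /\
  (forall z, mem z x -> exists y p, is_pair z y p /\ mem p (carrier P) /\
     (is_name P y \/ ur y)) /\
  (forall a p y q, ur a -> pair_in a p x -> pair_in y q x -> y <> a ->
     incompat P p q).
Proof.
  intros [T [HT Hx]]. destruct (HT x Hx) as (A & B & C).
  split; [exact A|]. split; [|exact C]. intros z Hz.
  destruct (B z Hz) as (y & p & H & H' & K). exists y, p.
  split; [exact H|]. split; [exact H'|]. destruct K; [left; now exists T | tauto].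
Qed.

Lemma name_not_ur x : is_name P x -> ~ ur x.
Proof. intros H. apply (name_elim x H). Qed.

Lemma name_pair x y p : is_name P x -> pair_in y p x ->
  mem p (carrier P) /\ (is_name P y \/ ur y).
Proof.
  intros Hx [z [Hz H]]. apply name_elim in Hx as (_ & K & _).
  destruct (K z H) as (y' & p' & H' & K').
  now destruct (pair_inj _ _ _ _ _ Hz H') as [-> ->].
Qed.

Lemma name_ur_uniq x a p y q r : is_name P x -> ur a ->
  pair_in a p x -> pair_in y q x -> ple P r p -> ple P r q -> y = a.
Proof.
  intros Hx Ha Hap Hyq Hrp Hrq. apply NNPP. intros Hn.
  apply name_elim in Hx as (_ & _ & K). apply (K a p y q Ha Hap Hyq Hn). eauto.
Qed.

Lemma subname_closed T x y p : name_closed P T -> mem x T -> pair_in y p x ->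
  is_name P y -> mem y T.
Proof.
  intros HT Hx [z [Hz H]] Hy. destruct (HT x Hx) as (_ & K & _).
  destruct (K z H) as (y' & p' & H' & _ & [C|C]);
    destruct (pair_inj _ _ _ _ _ Hz H') as [-> _]; [exact C|].
  destruct (name_not_ur _ Hy C).
Qed.

(** The least closed sets of the subnames are gathered by Replacement; their union with [x] adjoined
    is closed and witnesses that [x] is a name. *)
Lemma name_intro x : ~ ur x ->
  (forall z, mem z x -> exists y p, is_pair z y p /\ mem p (carrier P) /\
     (is_name P y \/ ur y)) ->
  (forall a p y q, ur a -> pair_in a p x -> pair_in y q x -> y <> a ->
     incompat P p q) -> is_name P x.
Proof.
  intros Hx Hp Hinc.
  assert (Hex : forall y, is_name P y -> exists T,
      least_closed P y T /\ name_closed P T /\ mem y T).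
  { intros y [T0 [HT0 Hy0]].
    destruct (sep HM (fun w => forall T', name_closed P T' -> mem y T' -> mem w T') T0)
      as [T [HuT HT]]; [dfn|].
    assert (HT' : forall w, mem w T <->
      forall T', name_closed P T' -> mem y T' -> mem w T').
    { intros w. rewrite HT. split; [tauto|]. auto. }
    exists T. split; [split; assumption|]. split; [|apply HT'; auto].
    intros w Hw. apply HT in Hw as [Hw0 Hw].
    destruct (HT0 w Hw0) as (A & B & C). split; [exact A|]. split; [|exact C].
    intros z Hz. destruct (B z Hz) as (v & p & Hzv & Hpc & [Hv|Hv]);
      exists v, p; split; auto; split; auto.
    left. apply HT'. intros T' HT'c HyT'.
    apply (subname_closed T' w v p); auto.
    - now exists z.
    - now exists T0. }
  destruct (union2_ex HM x) as [U [_ HU]].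
  destruct (sep HM (is_name P) U) as [U' [_ HU']]; [dfn|].
  destruct (repl HM (least_closed P) U') as [v [_ Hv]].
  { dfn. }
  { intros w T T' _ [H K] [H' K']. apply (set_ext HM); auto.
    intros z. now rewrite K, K'. }
  destruct (union_ex HM v) as [V [_ HV]].
  destruct (adjoin_ex HM V x) as [T [_ HT]].
  exists T. split; [|apply HT; tauto].
  intros w Hw. apply HT in Hw as [Hw| ->].
  - apply HV in Hw as [T' [HT' Hw]]. assert (HT'0 := HT').
    apply Hv in HT' as [y [Hy Hl]]. apply HU' in Hy as [_ Hy].
    destruct (Hex y Hy) as (T'' & [_ Hl'] & Hc & _).
    apply name_clause_mono with T''.
    + intros z Hz. apply HT. left. apply HV. exists T'. split; [exact HT'0|].
      apply Hl. now apply Hl'.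
    + apply Hc. apply Hl'. now apply Hl.
  - split; [exact Hx|]. split; [|exact Hinc].
    intros z Hz. destruct (Hp z Hz) as (y & p & H & H' & K).
    exists y, p. split; [exact H|]. split; [exact H'|].
    destruct K as [K|K]; [left | tauto].
    destruct (Hex y K) as (T' & Hl & Hc & HyT').
    apply HT. left. apply HV. exists T'. split; [|exact HyT'].
    apply Hv. exists y. split; [|exact Hl]. apply HU'. split; [|exact K].
    apply HU. destruct (pair_fst_mem _ _ _ H) as [u Hu]. exists z, u. tauto.
Qed.

Lemma name_ind (Q : M -> Prop) : def1 Q ->
  (forall x, is_name P x ->
    (forall y p, pair_in y p x -> is_name P y -> Q y) -> Q x) ->
  forall x, is_name P x -> Q x.
Proof.
  intros HQ IH. set (Q' := fun x => is_name P x -> Q x).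
  (* A subname of [x] is three membership steps below [x]. *)
  enough (H : forall x, Q' x /\ (forall y, mem y x -> Q' y) /\
      forall y z, mem y x -> mem z y -> Q' z) by (intros x; apply H).
  apply (mem_ind HM); [unfold Q'; dfn|].
  intros x K. assert (K1 := fun y Hy => proj1 (K y Hy)).
  assert (K2 : forall y z, mem y x -> mem z y -> Q' z).
  { intros y z Hy Hz. now apply (proj2 (K y Hy)). }
  split; [|split; assumption].
  intros Hx. apply IH; [exact Hx|]. intros y p [z [Hz Hzx]] Hy.
  destruct (pair_fst_mem _ _ _ Hz) as [u [Hu Hyu]].
  now apply (proj2 (proj2 (K z Hzx)) u y).
Qed.

End Names.

(** * The forcing relation *)

Section Forcing.
Context {M : ustructure} (P : poset M).
Hypothesis HM : ZFCU_R M.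

Lemma triple_in_iff (R p x y t : M) : is_pair t x y ->
  (triple_in p x y R <-> pair_in p t R).
Proof.
  intros H. split.
  - intros [t' [H' K]]. now rewrite (pair_uniq HM _ _ _ _ H H').
  - intros K. now exists t.
Qed.

Lemma tripleset (Q : M -> M -> M -> Prop) a b : def3 Q ->
  exists R, forall p x y, triple_in p x y R <->
    mem p a /\ mem x b /\ mem y b /\ Q p x y.
Proof.
  intros HQ.
  destruct (relset HM (fun _ _ => True) b b) as (bb & _ & _ & Hbb).
  { intros t u Ht Hu. apply definable_iff with (fun e => t e = t e); [tauto | dfn]. }
  destruct (relset HM (fun p t => exists x y, is_pair t x y /\ Q p x y) a bb)
    as (R & _ & _ & HR); [dfn|].
  exists R. intros p x y. destruct (pair_ex HM x y) as [t Ht].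
  rewrite (triple_in_iff R p x y t Ht), HR, <- (pair_in_iff HM _ _ _ _ Ht), Hbb.
  split.
  - intros (Hp & (Hx & Hy & _) & (x' & y' & H & HQp)).
    destruct (pair_inj _ _ _ _ _ Ht H) as [-> ->]. tauto.
  - intros (Hp & Hx & Hy & HQp). split; [exact Hp|]. split; [tauto|].
    now exists x, y.
Qed.

Section Monotone.
Variables (E E' : M -> M -> M -> Prop) (K : M -> Prop).
Hypothesis K_sub : forall x y r, K x -> pair_in y r x -> is_name P y -> K y.
Hypothesis E_impl : forall q x y, mem q (carrier P) -> K x -> K y ->
  E q x y -> E' q x y.

(** This and the next two lemmas express positivity in [E], relative to a class [K] closed under
    subnames: a set-sized relation can be compared with another only on a fixed closed set of
    names. *)
Lemma in_clause_impl p x1 x2 : K x1 -> K x2 ->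
  in_clause P E p x1 x2 -> in_clause P E' p x1 x2.
Proof.
  intros K1 K2. apply dense_below_impl. intros q (y & r & Hy & Hyr & Hq & H).
  exists y, r. repeat split; auto. apply E_impl; eauto.
  apply (ple_carrier _ _ _ Hq).
Qed.

Lemma sub_clause_impl p x1 x2 : K x1 -> K x2 ->
  sub_clause P E p x1 x2 -> sub_clause P E' p x1 x2.
Proof.
  intros K1 K2 H y r q Hy Hyr Hqp Hqr. apply in_clause_impl; eauto.
Qed.

Lemma eq_clause_impl p x1 x2 : K x1 -> K x2 ->
  eq_clause P E p x1 x2 -> eq_clause P E' p x1 x2.
Proof.
  intros K1 K2 (H1 & H2 & H3). split; [|split]; auto using sub_clause_impl.
Qed.
End Monotone.

Lemma eq_clause_impl_all (E E' : M -> M -> M -> Prop) p x1 x2 :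
  (forall q x y, E q x y -> E' q x y) ->
  eq_clause P E p x1 x2 -> eq_clause P E' p x1 x2.
Proof.
  intros H. apply (eq_clause_impl E E' (fun _ => True)); auto.
Qed.

Lemma eq_clause_le E p q x1 x2 : ple P q p ->
  eq_clause P E p x1 x2 -> eq_clause P E q x1 x2.
Proof.
  intros Hq (H1 & H2 & H3). split; [|split].
  - intros y r s Hy Hyr Hs. apply H1; auto. now apply ple_trans with q.
  - intros y r s Hy Hyr Hs. apply H2; auto. now apply ple_trans with q.
  - exact (dense_below_le _ _ _ _ Hq H3).
Qed.

Lemma forces_eq_elim p x1 x2 : forces_eq P p x1 x2 ->
  mem p (carrier P) /\ is_name P x1 /\ is_name P x2 /\
  eq_clause P (forces_eq P) p x1 x2.
Proof.
  intros (T & R & HA & Hp & H1 & H2 & H). assert (HT := HA).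
  destruct HT as [HT HR].
  split; [exact Hp|]. split; [now exists T|]. split; [now exists T|].
  apply HR in H; auto. revert H.
  apply (eq_clause_impl _ _ (fun x => mem x T)); auto.
  - intros x y r Hx Hy Hn. now apply (subname_closed P T x y r).
  - intros q y1 y2 Hq Hy1 Hy2 H. now exists T, R.
Qed.

(* The clause for equality is positive in the relation [E], so it has a greatest
   fixed point on every closed set of names, and a relation included in its own
   clause is included in forced equality. *)
Lemma forces_eq_coind (B : M -> M -> M -> Prop) : def3 B ->
  (forall p x1 x2, B p x1 x2 -> mem p (carrier P) /\ is_name P x1 /\
     is_name P x2 /\ eq_clause P B p x1 x2) ->
  forall p x1 x2, B p x1 x2 -> forces_eq P p x1 x2.
Proof.
  intros HB Hpost p x1 x2 H0.
  destruct (Hpost _ _ _ H0) as (Hp & [T1 [HT1 Hx1]] & [T2 [HT2 Hx2]] & _).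
  destruct (binunion_ex HM T1 T2) as [T [_ HT]].
  assert (HTc : name_closed P T).
  { intros w Hw. apply HT in Hw as [Hw|Hw].
    - apply (name_clause_mono P T1); [intros y; rewrite HT; tauto | auto].
    - apply (name_clause_mono P T2); [intros y; rewrite HT; tauto | auto]. }
  assert (Tsub : forall x y r, mem x T -> pair_in y r x -> is_name P y -> mem y T).
  { intros x y r Hx Hy Hn. now apply (subname_closed P T x y r). }
  set (ofset := fun R q y1 y2 : M => triple_in q y1 y2 R).
  set (post := fun R => forall q y1 y2, mem q (carrier P) -> mem y1 T -> mem y2 T ->
    ofset R q y1 y2 -> eq_clause P (ofset R) q y1 y2).
  (* As in the Knaster-Tarski theorem, the greatest fixed point on [T] is the union of all
     post-fixed points. *)
  destruct (tripleset (fun q y1 y2 => exists R, post R /\ ofset R q y1 y2)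
    (carrier P) T) as [R HR].
  { unfold post, ofset. dfn. }
  assert (HRpost : post R).
  { intros q y1 y2 Hq Hy1 Hy2 H. apply HR in H as (_ & _ & _ & R' & HR' & H).
    apply (HR' q y1 y2 Hq Hy1 Hy2) in H. revert H.
    apply (eq_clause_impl _ _ (fun x => mem x T)); auto.
    intros s z1 z2 Hs Hz1 Hz2 H. apply HR. eauto 6. }
  assert (HRA : eq_attempt P T R).
  { split; [exact HTc|]. intros q y1 y2 Hq Hy1 Hy2. split; [now apply HRpost|].
    (* [R'] is the image of [R] under the clause. It is post-fixed by monotonicity, hence contained
       in [R]. *)
    intros H. destruct (tripleset (eq_clause P (ofset R)) (carrier P) T) as [R' HR'].
    { unfold ofset. dfn. }
    apply HR. split; [exact Hq|]. split; [exact Hy1|]. split; [exact Hy2|].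
    exists R'. split; [|apply HR'; auto].
    intros s z1 z2 Hs Hz1 Hz2 K. apply HR' in K as (_ & _ & _ & K). revert K.
    apply (eq_clause_impl _ _ (fun x => mem x T)); auto.
    intros s' w1 w2 Hs' Hw1 Hw2 K. apply HR'. auto. }
  exists T, R. assert (Hx1T : mem x1 T) by (apply HT; tauto).
  assert (Hx2T : mem x2 T) by (apply HT; tauto).
  repeat (split; [assumption|]).
  (* The part of [B] on [T] is post-fixed, since [T] contains the subnames of its members. *)
  destruct (tripleset B (carrier P) T HB) as [R' HR'].
  apply HR. repeat (split; [assumption|]).
  exists R'. split; [|now apply HR'].
  intros q y1 y2 Hq Hy1 Hy2 K. apply HR' in K as (_ & _ & _ & K).
  apply Hpost in K as (_ & _ & _ & K). revert K.
  apply (eq_clause_impl _ _ (fun x => mem x T)); auto.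
  intros s z1 z2 Hs Hz1 Hz2 K. apply HR'. auto.
Qed.

Lemma definable_forces_eq : def3 (forces_eq P).
Proof. dfn. Qed.

End Forcing.

Ltac dfn_forces := first [ dfn_names | apply definable_forces_eq ].
Ltac dfn_hint ::= dfn_forces.

(** * Laws of forced equality, congruence of forcing, and mixing *)

Section ForcedEquality.
Context {M : ustructure} (P : poset M).
Hypothesis HM : ZFCU_R M.

(** The clause applied to forced equality is a relation included in its own clause, by unfolding and
    monotonicity, so coinduction gives the converse of unfolding. *)
Lemma forces_eq_intro p x1 x2 : mem p (carrier P) -> is_name P x1 -> is_name P x2 ->
  eq_clause P (forces_eq P) p x1 x2 -> forces_eq P p x1 x2.
Proof.
  intros Hp H1 H2 H.
  apply (forces_eq_coind P HM (fun p x1 x2 => mem p (carrier P) /\ is_name P x1 /\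
    is_name P x2 /\ eq_clause P (forces_eq P) p x1 x2)); [dfn| |auto].
  intros q y1 y2 (Hq & Hy1 & Hy2 & K). repeat (split; [assumption|]).
  revert K. apply eq_clause_impl_all. apply forces_eq_elim.
Qed.

Lemma forces_eq_le p q x1 x2 : ple P q p -> forces_eq P p x1 x2 -> forces_eq P q x1 x2.
Proof.
  intros Hq H. apply forces_eq_elim in H as (Hp & H1 & H2 & H).
  apply forces_eq_intro; auto.
  - apply (ple_carrier P _ _ Hq).
  - exact (eq_clause_le P _ _ _ _ _ Hq H).
Qed.

Lemma forces_ureq_refl p x : forces_ureq P p x x.
Proof.
  intros q Hq.
  destruct (classic (exists a r, ur a /\ pair_in a r x /\ ~ incompat P q r))
    as [(a & r & Ha & Har & K)|K].
  - apply not_incompat in K as [s [Hs Hsr]]. exists s. split; [exact Hs|].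
    left. exists a, r, r. auto.
  - exists q. split; [exact (ple_refl_l P _ _ Hq)|]. right.
    split; [apply (ple_carrier P _ _ Hq)|]. intros a r Ha Har.
    apply NNPP. intros Hn. apply K. exists a, r. tauto.
Qed.

Lemma forces_ureq_sym p x y : forces_ureq P p x y -> forces_ureq P p y x.
Proof.
  apply dense_below_impl. intros q [(a & r1 & r2 & H)|[Hq H]].
  - left. exists a, r2, r1. tauto.
  - right. split; [exact Hq|]. intros a r Ha K. apply (H a r Ha). tauto.
Qed.

(** Below a common condition the name [y] carries at most one urelement, so the two witnesses
    through [y] coincide; the mixed cases contradict incompatibility. *)
Lemma forces_ureq_trans p x y z : is_name P y ->
  forces_ureq P p x y -> forces_ureq P p y z -> forces_ureq P p x z.
Proof.
  intros Hy Hxy Hyz q Hq. destruct (Hxy q Hq) as [s [Hs Ks]].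
  destruct (Hyz s (ple_trans P _ _ _ Hs Hq)) as [t [Ht Kt]].
  exists t. split; [exact (ple_trans P _ _ _ Ht Hs)|].
  destruct Ks as [(a & r1 & r2 & Ha & H1 & H2 & L1 & L2)|[_ Ks]];
    destruct Kt as [(b & s1 & s2 & Hb & G1 & G2 & N1 & N2)|[Htc Kt]].
  - left. exists a, r1, s2.
    assert (E : b = a).
    { apply (name_ur_uniq P y a r2 b s1 t); auto. exact (ple_trans P _ _ _ Ht L2). }
    subst b. repeat split; auto. exact (ple_trans P _ _ _ Ht L1).
  - destruct (Kt a r2 Ha (or_introl H2)). exists t.
    split; [exact (ple_refl_l P _ _ Ht) | exact (ple_trans P _ _ _ Ht L2)].
  - destruct (Ks b s1 Hb (or_intror G1)). eauto.
  - right. split; [exact Htc|]. intros a r Ha [K|K]; [|apply (Kt a); tauto].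
    apply incompat_le with s; [exact Ht|]. apply (Ks a); tauto.
Qed.

Lemma forces_eq_refl p x : mem p (carrier P) -> is_name P x -> forces_eq P p x x.
Proof.
  intros Hp Hx.
  apply (forces_eq_coind P HM (fun p x y => mem p (carrier P) /\ is_name P x /\ x = y));
    [dfn| |auto].
  clear. intros p x y (Hp & Hx & <-). repeat (split; [assumption|]).
  assert (H : sub_clause P (fun p x y => mem p (carrier P) /\ is_name P x /\ x = y) p x x).
  { intros y r q Hy Hyr _ Hqr. apply dense_below_all. intros s Hs. exists y, r.
    split; [exact Hy|]. split; [exact Hyr|]. split; [exact (ple_trans P _ _ _ Hs Hqr)|].
    split; [apply (ple_carrier P _ _ Hs) | auto]. }
  split; [exact H|]. split; [exact H|]. apply forces_ureq_refl.
Qed.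

Lemma eq_clause_sym E p x y : eq_clause P E p x y -> eq_clause P E p y x.
Proof.
  intros (H1 & H2 & H3). split; [exact H2|]. split; [exact H1|].
  now apply forces_ureq_sym.
Qed.

Lemma forces_eq_sym p x y : forces_eq P p x y -> forces_eq P p y x.
Proof.
  intros H.
  apply (forces_eq_coind P HM (fun p x y => forces_eq P p x y \/ forces_eq P p y x));
    [dfn| |auto].
  clear. intros p x y [H|H]; apply forces_eq_elim in H as (Hp & Hx & Hy & H);
    repeat (split; [assumption|]).
  - revert H. apply eq_clause_impl_all. tauto.
  - apply eq_clause_sym in H. revert H. apply eq_clause_impl_all. tauto.
Qed.

Definition eq_comp p x z : Prop := exists y, forces_eq P p x y /\ forces_eq P p y z.

Lemma sub_clause_comp p x1 x2 x3 :
  sub_clause P (forces_eq P) p x1 x2 -> sub_clause P (forces_eq P) p x2 x3 ->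
  sub_clause P eq_comp p x1 x3.
Proof.
  intros H12 H23 y r q Hy Hyr Hqp Hqr. apply dense_below_dense.
  intros s Hs. destruct (H12 y r q Hy Hyr Hqp Hqr s Hs)
    as (t & Ht & y2 & r2 & Hy2 & Hyr2 & Htr2 & E2).
  exists t. split; [exact Ht|].
  assert (Htp : ple P t p) by eauto using ple_trans.
  generalize (H23 y2 r2 t Hy2 Hyr2 Htp Htr2).
  intros K u Hu. destruct (K u Hu) as (v & Hv & y3 & r3 & Hy3 & Hyr3 & Hvr3 & E3).
  exists v. split; [exact Hv|]. exists y3, r3. repeat (split; [assumption|]).
  exists y2. split; [exact E3|]. apply forces_eq_le with t; [|exact E2].
  exact (ple_trans P _ _ _ Hv Hu).
Qed.

Lemma forces_eq_trans p x y z :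
  forces_eq P p x y -> forces_eq P p y z -> forces_eq P p x z.
Proof.
  intros Hxy Hyz.
  apply (forces_eq_coind P HM eq_comp); [unfold eq_comp; dfn| |now exists y].
  clear - HM. intros p x z [y [Hxy Hyz]].
  apply forces_eq_elim in Hxy as (Hp & Hx & Hy & H1 & H2 & H3).
  apply forces_eq_elim in Hyz as (_ & _ & Hz & G1 & G2 & G3).
  repeat (split; [assumption|]).
  split; [|split].
  - now apply sub_clause_comp with y.
  - now apply sub_clause_comp with y.
  - now apply forces_ureq_trans with y.
Qed.

Lemma forces_sub_trans p x y z :
  forces_sub P p x y -> forces_sub P p y z -> forces_sub P p x z.
Proof.
  intros Hxy Hyz. generalize (sub_clause_comp _ _ _ _ Hxy Hyz).
  apply (sub_clause_impl P _ _ (fun _ => True)); auto.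
  intros q u w _ _ _ [v [H H']]. now apply forces_eq_trans with v.
Qed.

Lemma forces_eq_sub p x y : forces_eq P p x y -> forces_sub P p x y.
Proof. intros H. apply (forces_eq_elim P _ _ _ H). Qed.

Lemma forces_eq_ureq p x y : forces_eq P p x y -> forces_ureq P p x y.
Proof. intros H. apply (forces_eq_elim P _ _ _ H). Qed.

Lemma forces_le phi : forall e p q, ple P q p -> forces P p phi e -> forces P q phi e.
Proof.
  induction phi as [i j|i j|i j|i|i j|f IH|f IHf g IHg|f IH]; simpl; intros e p q Hq.
  - intros H y r s Hy Hyr Hs. apply H; auto. now apply ple_trans with q.
  - now apply forces_eq_le.
  - now apply dense_below_le.
  - now apply dense_below_le.
  - now apply dense_below_le.
  - intros H r Hr. apply H. now apply ple_trans with q.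
  - intros [H H']. split; eauto.
  - now apply dense_below_le.
Qed.

Lemma forces_sub_dense p x y :
  dense_below P (fun q => forces_sub P q x y) p -> forces_sub P p x y.
Proof.
  intros H z r q Hz Hzr Hqp Hqr. apply dense_below_dense. intros s Hs.
  destruct (H s (ple_trans P _ _ _ Hs Hqp)) as [t [Ht K]].
  exists t. split; [exact Ht|]. apply (K z r); auto.
  - exact (ple_refl_l P _ _ Ht).
  - eauto using ple_trans.
Qed.

(** A mixed name is seen to satisfy a formula only on a dense set of conditions; this carries the
    formula up to the given condition. *)
Lemma forces_dense phi : forall e p, (forall i, is_name P (e i)) ->
  mem p (carrier P) -> dense_below P (fun q => forces P q phi e) p -> forces P p phi e.
Proof.
  induction phi as [i j|i j|i j|i|i j|f IH|f IHf g IHg|f IH];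
    simpl; intros e p He Hp H.
  - now apply forces_sub_dense.
  - apply forces_eq_intro; auto. split; [|split].
    + apply forces_sub_dense. revert H. apply dense_below_impl.
      intros q. apply forces_eq_sub.
    + apply forces_sub_dense. revert H. apply dense_below_impl.
      intros q H. now apply forces_eq_sub, forces_eq_sym.
    + apply dense_below_dense. revert H. apply dense_below_impl.
      intros q. apply forces_eq_ureq.
  - now apply dense_below_dense.
  - now apply dense_below_dense.
  - now apply dense_below_dense.
  - intros q Hq K. destruct (H q Hq) as [r [Hr Hn]].
    apply (Hn r (ple_refl_l P _ _ Hr)). now apply forces_le with q.
  - split; [apply IHf | apply IHg]; auto; revert H; apply dense_below_impl; tauto.
  - now apply dense_below_dense.
Qed.

Lemma forces_in_congr p x x' y y' : forces_eq P p x x' -> forces_eq P p y y' ->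
  forces_in P p x y -> forces_in P p x' y'.
Proof.
  intros Hx Hy H. apply dense_below_dense. intros q Hq.
  destruct (H q Hq) as (s & Hs & z & r & Hz & Hzr & Hsr & E).
  exists s. split; [exact Hs|].
  assert (Hsp : ple P s p) by exact (ple_trans P _ _ _ Hs Hq).
  generalize (forces_eq_sub _ _ _ Hy z r s Hz Hzr Hsp Hsr).
  intros K t Ht. destruct (K t Ht) as (u & Hu & w & r' & Hw & Hwr & Hur & E').
  exists u. split; [exact Hu|]. exists w, r'. repeat (split; [assumption|]).
  apply forces_eq_trans with z; [exact E'|].
  assert (Hus : ple P u s) by exact (ple_trans P _ _ _ Hu Ht).
  apply forces_eq_trans with x.
  - now apply forces_eq_le with s.
  - apply forces_eq_le with p; [exact (ple_trans P _ _ _ Hus Hsp) | exact Hx].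
Qed.

Lemma forces_ur_congr p x y : forces_eq P p x y -> forces_ur P p x -> forces_ur P p y.
Proof.
  intros E H q Hq. destruct (H q Hq) as (s & Hs & a & r & Ha & Har & Hsr).
  destruct (forces_eq_ureq _ _ _ E s (ple_trans P _ _ _ Hs Hq))
    as (t & Ht & [(b & r1 & r2 & Hb & _ & Hbr & _ & Htr)|[_ K]]).
  - exists t. split; [exact (ple_trans P _ _ _ Ht Hs)|]. now exists b, r2.
  - destruct (K a r Ha (or_introl Har)). exists t.
    split; [exact (ple_refl_l P _ _ Ht) | exact (ple_trans P _ _ _ Ht Hsr)].
Qed.

Lemma forces_congr phi : forall e e' p, (forall i, forces_eq P p (e i) (e' i)) ->
  forces P p phi e -> forces P p phi e'.
Proof.
  induction phi as [i j|i j|i j|i|i j|f IH|f IHf g IHg|f IH];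
    simpl; intros e e' p E H.
  - apply forces_sub_trans with (e i); [now apply forces_eq_sub, forces_eq_sym|].
    apply forces_sub_trans with (e j); [exact H | now apply forces_eq_sub].
  - apply forces_eq_trans with (e i); [now apply forces_eq_sym|].
    now apply forces_eq_trans with (e j).
  - now apply forces_in_congr with (e i) (e j).
  - now apply forces_ur_congr with (e i).
  - apply forces_ureq_trans with (e i);
      [apply (forces_eq_elim P _ _ _ (E i))
      | now apply forces_ureq_sym, forces_eq_ureq |].
    apply forces_ureq_trans with (e j);
      [apply (forces_eq_elim P _ _ _ (E j)) | exact H | now apply forces_eq_ureq].
  - intros q Hq K. apply (H q Hq). revert K. apply IH.
    intros i. apply forces_eq_sym, forces_eq_le with p; auto.
  - split; [apply IHf with e | apply IHg with e]; tauto.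
  - intros q Hq. destruct (H q Hq) as (s & Hs & z & Hz & K).
    exists s. split; [exact Hs|]. exists z. split; [exact Hz|]. revert K. apply IH.
    intros [|i]; simpl.
    + apply forces_eq_refl; [apply (ple_carrier P _ _ Hs) | exact Hz].
    + apply forces_eq_le with p; [exact (ple_trans P _ _ _ Hs Hq) | apply E].
Qed.

(* Below the first component [q] of a pair [<q, x>] of [A], the mixed name has
   the elements of [x], with conditions strengthened to lie below [q]. *)
Lemma mixing A :
  (forall q x, pair_in q x A -> mem q (carrier P) /\ is_name P x) ->
  (forall q x q' x' r, pair_in q x A -> pair_in q' x' A ->
     ple P r q -> ple P r q' -> x = x') ->
  exists y, is_name P y /\ forall q x, pair_in q x A -> forces_eq P q y x.
Proof.
  intros HAn HAi.
  (* Unions descend through the Kuratowski pairs: [U1] contains the names [x], [U2] their elements,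
     and [U] the first components of these. *)
  destruct (union2_ex HM A) as [U1 [_ HU1]].
  destruct (union_ex HM U1) as [U2 [_ HU2]].
  destruct (union2_ex HM U2) as [U [_ HU]].
  set (mix := fun z r : M => exists q x s : M, pair_in q x A /\ pair_in z s x /\
    ple P r q /\ ple P r s).
  destruct (relset HM mix U (carrier P)) as (y & Huy & Hy1 & Hy0).
  { unfold mix. dfn. }
  assert (Hy : forall z r, pair_in z r y <-> mix z r).
  { intros z r. rewrite Hy0. split; [tauto|]. intros H. assert (H' := H).
    destruct H' as (q & x & s & HqA & Hzx & Hrq & Hrs).
    split; [|split; [apply (ple_carrier P _ _ Hrq) | exact H]].
    destruct HqA as [a [Ha HaA]]. destruct Hzx as [b [Hb Hbx]].
    destruct (pair_snd_mem _ _ _ Ha) as [c [Hc Hxc]].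
    destruct (pair_fst_mem _ _ _ Hb) as [d [Hd Hzd]].
    apply HU. exists b, d. split; [|tauto]. apply HU2. exists x.
    split; [|exact Hbx]. apply HU1. exists a, c. tauto. }
  assert (Hn : is_name P y).
  { apply (name_intro P HM); [exact Huy| |].
    - intros t Ht. destruct (Hy1 t Ht) as (z & r & Htp & _ & Hr & H).
      exists z, r. split; [exact Htp|]. split; [exact Hr|].
      destruct H as (q & x & s & HqA & Hzx & _).
      now apply (name_pair P x z s (proj2 (HAn _ _ HqA))).
    - intros a p z r Ha Hap Hzr Hne [t [Htp Htr]].
      apply Hy in Hap as (q & x & s & HqA & Hax & Hpq & Hps).
      apply Hy in Hzr as (q' & x' & s' & HqA' & Hzx & Hrq & Hrs).
      assert (x' = x).
      { apply (HAi q' x' q x t); auto; eauto using ple_trans. }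
      subst x'. apply Hne.
      apply (name_ur_uniq P x a s z s' t); auto; [|eauto using ple_trans..].
      now apply (HAn q). }
  exists y. split; [exact Hn|]. intros q x Hqx.
  destruct (HAn q x Hqx) as [Hq Hx].
  assert (Hin : forall z r t, pair_in z r y -> ple P t q -> ple P t r ->
    exists s, pair_in z s x /\ ple P r s).
  { intros z r t Hz Htq Htr. apply Hy in Hz as (q' & x' & s & HqA & Hzx & Hrq & Hrs).
    assert (x' = x).
    { apply (HAi q' x' q x t); auto; eauto using ple_trans. }
    subst x'. eauto. }
  apply forces_eq_intro; auto. split; [|split].
  - intros z r t Hz Hzr Htq Htr. destruct (Hin z r t Hzr Htq Htr) as [s [Hs Hrs]].
    apply dense_below_all. intros u Hu. exists z, s.
    repeat (split; [eauto using ple_trans|]).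
    apply forces_eq_refl; [apply (ple_carrier P _ _ Hu) | exact Hz].
  - intros z r t Hz Hzr Htq Htr.
    (* The mixed name contains [z] with every condition below both [q] and [r], so [t] itself
       serves. *)
    apply dense_below_all. intros u Hu. exists z, t. split; [exact Hz|].
    split; [|split; [exact Hu|]].
    + apply Hy. now exists q, x, r.
    + apply forces_eq_refl; [apply (ple_carrier P _ _ Hu) | exact Hz].
  - intros t Ht.
    destruct (classic (exists a r, ur a /\ pair_in a r x /\ ~ incompat P t r))
      as [(a & r & Ha & Har & K)|K].
    + apply not_incompat in K as [s [Hs Hsr]]. exists s. split; [exact Hs|].
      left. exists a, s, r. split; [exact Ha|]. split; [|split; [exact Har|]].
      * apply Hy. exists q, x, r. eauto using ple_trans.
      * split; [exact (ple_refl_l P _ _ Hs) | exact Hsr].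
    + exists t. split; [exact (ple_refl_l P _ _ Ht)|]. right.
      split; [apply (ple_carrier P _ _ Ht)|]. intros a r Ha Har.
      apply NNPP. intros Hc. apply K. destruct Har as [Har|Har]; [|eauto].
      apply not_incompat in Hc as [u [Hut Hur]].
      destruct (Hin a r u Har) as [s [Hs Hrs]]; [eauto using ple_trans|auto|].
      exists a, s. split; [exact Ha|]. split; [exact Hs|]. intros Hinc.
      apply Hinc. exists u. eauto using ple_trans.
Qed.

(** The induction on [phi] is external. The valuation [env] is itself a function of the arguments,
    because a quantifier shifts them and prepends the bound name. *)
Lemma definable_forces phi : forall t (env : (nat -> M) -> nat -> M),
  is_term t -> (forall n, is_term (fun e => env e n)) ->
  definable (fun e => forces P (t e) phi (env e)).
Proof.
  assert (Hr : forall (env : (nat -> M) -> nat -> M) (r : nat -> nat) n,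
    (forall n, is_term (fun e => env e n)) ->
    is_term (fun e => env (fun k => e (r k)) n)).
  { intros env r n H. exact (term_ren _ r (H n)). }
  assert (D2 : def2 (forces_ur P)) by dfn.
  assert (D3 : def3 (forces_sub P) /\ def3 (forces_in P) /\ def3 (forces_ureq P))
    by (repeat split; dfn).
  destruct D3 as (Dsub & Din & Dureq).
  induction phi as [i j|i j|i j|i|i j|f IH|f IHf g IHg|f IH];
    simpl; intros t env Ht He.
  - exact (Dsub t _ _ Ht (He i) (He j)).
  - exact (definable_forces_eq P t _ _ Ht (He i) (He j)).
  - exact (Din t _ _ Ht (He i) (He j)).
  - exact (D2 t _ Ht (He i)).
  - exact (Dureq t _ _ Ht (He i) (He j)).
  - apply definable_all, definable_imp; [dfn|]. apply definable_not.
    apply (IH (fun e => e 0) (fun e => env (fun n => e (S n)))); [dfn|].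
    intros n. now apply Hr.
  - apply definable_and; auto.
  - unfold dense_below.
    apply definable_all, definable_imp; [dfn|].
    apply definable_ex, definable_and; [dfn|].
    apply definable_ex, definable_and; [dfn|].
    (* Here [e 0] is the bound name, [e 1] the condition in the dense set, [e 2] the condition above
       it, and the original arguments start at index 3. *)
    apply (IH (fun e => e 1) (fun e => scons (e 0) (env (fun n => e (S (S (S n)))))));
      [dfn|].
    intros [|n]; simpl; [dfn | now apply Hr].
Qed.

End ForcedEquality.

(** * Collection implies fullness *)

Lemma collection_fullness (M : ustructure) (HM : ZFCU_R M) :
  Collection M -> Fullness M.
Proof.
  intros HC P phi e He p Hp Hex.
  set (wit := fun q z => is_name P z /\ forces P q phi (scons z e)).
  assert (Dwit : def2 wit).
  { intros t u Ht Hu. apply definable_and; [dfn|].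
    apply (definable_forces P phi t (fun a => scons (u a) e)); [exact Ht|].
    intros [|n]; simpl; dfn. }
  destruct (sep HM (fun q => exists z, wit q z) (carrier P)) as [D [_ HD]]; [dfn|].
  destruct (def2_sat p _ Dwit) as [f [e0 Hf]].
  destruct (HC f e0 D) as [v Hv].
  { intros q Hq. apply HD in Hq as [_ [z Hz]]. exists z. now apply Hf. }
  (* With the names bounded by [v], the witnessing pairs kept here form a set, out of which an
     antichain can be chosen. *)
  destruct (relset HM (fun q z => ple P q p /\ wit q z) (carrier P) v)
    as (W & _ & HW1 & HW2); [dfn|].
  (* A clique of pairs from [W] for this relation is an antichain in its first components, with at
     most one name at each condition. *)
  set (R := fun a b => exists q x q' x', is_pair a q x /\ is_pair b q' x' /\
    incompat P q q').
  destruct (maximal_clique HM R W) as (A & HA1 & HA2 & HA3).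
  { unfold R. dfn. }
  { intros a b (q & x & q' & x' & H & H' & K). exists q', x', q, x.
    split; [exact H'|]. split; [exact H | now apply incompat_sym]. }
  assert (HA : forall q x, pair_in q x A -> pair_in q x W).
  { intros q x [z [Hz H]]. exists z. auto. }
  destruct (mixing P HM A) as (y & Hy & Hmix).
  - intros q x H. apply HA, HW2 in H as (Hq & _ & _ & Hx & _). tauto.
  - intros q x q' x' r [a [Ha HaA]] [b [Hb HbA]] Hr Hr'.
    destruct (HA2 a b HaA HbA) as [<-|(s & z & s' & z' & Ha' & Hb' & K)].
    + apply (pair_inj _ _ _ _ _ Ha Hb).
    + destruct (pair_inj _ _ _ _ _ Ha Ha') as [<- <-].
      destruct (pair_inj _ _ _ _ _ Hb Hb') as [<- <-].
      destruct K. eauto.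
  - exists y. split; [exact Hy|]. apply forces_dense; auto.
    { intros [|i]; simpl; auto. }
    intros q Hq. destruct (Hex q Hq) as (d & Hd & Hdw).
    assert (Hdc : mem d (carrier P)) by apply (ple_carrier P _ _ Hd).
    destruct (Hv d) as (z & Hz & Hdz).
    { apply HD. split; [exact Hdc | exact Hdw]. }
    apply Hf in Hdz. destruct (pair_ex HM d z) as [c Hc].
    assert (HcW : mem c W).
    { apply (pair_in_iff HM _ _ _ W Hc), HW2. repeat (split; [assumption|]).
      split; [exact (ple_trans P _ _ _ Hd Hq) | exact Hdz]. }
    (* Maximality gives a pair in [A] whose condition is compatible with [d]. At a common extension
       the mixed name equals the name in that pair, so the formula transfers. *)
    destruct (HA3 c HcW) as (a & HaA & Hac).
    destruct (HW1 a (HA1 a HaA)) as (s & x & Ha & Hs & _ & _ & _ & Hsx).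
    assert (Hcompat : exists r, ple P r d /\ ple P r s).
    { destruct Hac as [-> | Hac].
      - destruct (pair_inj _ _ _ _ _ Ha Hc) as [-> _].
        exists d. split; now apply ple_refl.
      - apply not_incompat. intros K. apply Hac. exists s, x, d, z.
        split; [exact Ha|]. split; [exact Hc | now apply incompat_sym]. }
    destruct Hcompat as (r & Hrd & Hrs). exists r.
    split; [exact (ple_trans P _ _ _ Hrd Hd)|].
    assert (Hrc : mem r (carrier P)) by apply (ple_carrier P _ _ Hrd).
    apply (forces_congr P HM phi (scons x e)).
    + intros [|i]; simpl; [|now apply forces_eq_refl].
      apply forces_eq_sym, forces_eq_le with s; auto.
      apply Hmix. now exists a.
    + now apply forces_le with s.
Qed.

(** * Canonical names and truth at an atom *)

Section CheckNames.
Context {M : ustructure} (P : poset M).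
Hypothesis HM : ZFCU_R M.

(** The canonical name of an urelement [a] has the pair of [a] and the top as its only element; that
    of a set pairs the canonical names of its elements with the top. An attempt is a set of pairs
    whose first components are closed under passing to elements and which obeys this recursion. *)
Definition check_attempt (g : M) : Prop := forall y n, pair_in y n g ->
  ~ ur n /\
  (ur y -> forall z, mem z n <-> is_pair z y (top P)) /\
  (~ ur y ->
    (forall z, mem z n <->
      exists y' n', mem y' y /\ pair_in y' n' g /\ is_pair z n' (top P)) /\
    forall y', mem y' y -> exists n', pair_in y' n' g).

(* [check y n]: n is the canonical name of y *)
Definition check (y n : M) : Prop := exists g, check_attempt g /\ pair_in y n g.

Lemma definable_check : def2 check.
Proof. dfn. Qed.

Lemma check_uniq y : forall n n', check y n -> check y n' -> n = n'.
Proof.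
  apply (mem_ind HM (fun y => forall n n', check y n -> check y n' -> n = n')).
  { unfold check, check_attempt. dfn. }
  clear y. intros y IH n n' (g & Hg & H) (g' & Hg' & H').
  destruct (Hg _ _ H) as (Hn & H1 & H2), (Hg' _ _ H') as (Hn' & H1' & H2').
  apply (set_ext HM); auto. intros z.
  destruct (classic (ur y)) as [Hy|Hy].
  { rewrite H1, H1' by exact Hy. reflexivity. }
  destruct (H2 Hy) as [H3 H4], (H2' Hy) as [H3' H4']. rewrite H3, H3'.
  split; intros (u & k & Hu & Hk & Hz); exists u, k; repeat split; auto.
  - destruct (H4' u Hu) as [k' Hk']. replace k with k'; [exact Hk'|].
    symmetry. apply (IH u Hu); [now exists g | now exists g'].
  - destruct (H4 u Hu) as [k' Hk']. replace k with k'; [exact Hk'|].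
    apply (IH u Hu); [now exists g | now exists g'].
Qed.

Lemma check_ex y : exists n, check y n.
Proof.
  apply (mem_ind HM (fun y => exists n, check y n)).
  { unfold check, check_attempt. dfn. }
  (* Arguing by contradiction keeps [y] out of the domain of every attempt, so a pair adjoined at
     [y] later cannot clash with older ones. *)
  clear y. intros y IH. apply NNPP. intros Hno.
  destruct (transitive_closure_ex HM y) as (T & HyT & HT).
  destruct (graph_ex HM check T) as (g & _ & Hg).
  { unfold check, check_attempt. dfn. }
  { intros u n n' _. apply check_uniq. }
  assert (Hatt : check_attempt g).
  { intros u n H. apply Hg in H as [HuT [g' [Hg' H]]].
    destruct (Hg' _ _ H) as (Hn & H1 & H2). split; [exact Hn|].
    split; [exact H1|]. intros Hu. destruct (H2 Hu) as [H3 H4]. split.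
    - intros z. rewrite H3. split; intros (u' & k & Hu' & Hk & Hz);
        exists u', k; (split; [exact Hu'|]); (split; [|exact Hz]).
      + apply Hg. split; [now apply (HT u) | now exists g'].
      + apply Hg in Hk as [_ Hk]. destruct (H4 u' Hu') as [k' Hk'].
        replace k with k'; [exact Hk'|]. apply (check_uniq u'); [now exists g' | exact Hk].
    - intros u' Hu'. destruct (H4 u' Hu') as [k Hk]. exists k. apply Hg.
      split; [now apply (HT u) | now exists g']. }
  assert (Hn : exists n, ~ ur n /\
    (ur y -> forall z, mem z n <-> is_pair z y (top P)) /\
    (~ ur y -> forall z, mem z n <->
      exists u k, mem u y /\ pair_in u k g /\ is_pair z k (top P))).
  { destruct (classic (ur y)) as [Hy|Hy].
    - destruct (pair_ex HM y (top P)) as [c Hc].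
      destruct (singleton_ex HM c) as [n [Hn Kn]]. exists n. split; [exact Hn|].
      split; [|tauto]. intros _ z. rewrite Kn. split; [now intros ->|].
      intros Hz. exact (pair_uniq HM _ _ _ _ Hz Hc).
    - destruct (repl HM (fun u z => exists k, pair_in u k g /\ is_pair z k (top P)) y)
        as [n [Hn Kn]].
      { dfn. }
      { intros u z z' _ (k & Hk & Hz) (k' & Hk' & Hz').
        apply Hg in Hk as [_ Hk]. apply Hg in Hk' as [_ Hk'].
        rewrite (check_uniq u k k' Hk Hk') in Hz.
        exact (pair_uniq HM _ _ _ _ Hz Hz'). }
      exists n. split; [exact Hn|]. split; [tauto|]. intros _ z. rewrite Kn.
      split.
      + intros (u & Hu & k & Hk). exists u, k. tauto.
      + intros (u & k & Hu & Hk). exists u. split; [exact Hu|]. now exists k. }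
  destruct Hn as (n & Hn & Hn1 & Hn2).
  destruct (adjoin_pair_ex HM g y n) as (g' & _ & Hg').
  apply Hno. exists n, g'. split; [|apply Hg'; tauto].
  (* The new pair gives no value to an element of an old argument, nor to an element of [y], so the
     recursion equations are undisturbed. *)
  assert (Hold : forall u k u', pair_in u k g \/ u = y ->
    mem u' u -> forall k', pair_in u' k' g' <-> pair_in u' k' g).
  { intros u k u' Hu Hu' k'. rewrite Hg'. split; [|tauto].
    intros [H|[-> ->]]; [exact H|]. exfalso. destruct Hu as [Hu| ->].
    - destruct (Hatt _ _ Hu) as (_ & _ & H).
      destruct H as [_ H]; [exact (not_ur_mem HM _ _ Hu')|].
      destruct (H y Hu') as [k' Hk']. apply Hno. exists k'. now exists g.
    - exact (mem_irrefl HM _ Hu'). }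
  intros u k Hu. apply Hg' in Hu as [Hu|[-> ->]].
  - destruct (Hatt _ _ Hu) as (Hk & H1 & H2). split; [exact Hk|].
    split; [exact H1|]. intros Hur. destruct (H2 Hur) as [H3 H4]. split.
    + intros z. rewrite H3. split; intros (u' & k' & Hu' & Hk' & Hz);
        exists u', k'; (split; [exact Hu'|]); (split; [|exact Hz]);
        now apply (Hold u k u' (or_introl Hu) Hu').
    + intros u' Hu'. destruct (H4 u' Hu') as [k' Hk']. exists k'. apply Hg'. tauto.
  - split; [exact Hn|]. split; [exact Hn1|]. intros Hur. split.
    + intros z. rewrite Hn2 by exact Hur.
      split; intros (u' & k' & Hu' & Hk' & Hz);
        exists u', k'; (split; [exact Hu'|]); (split; [|exact Hz]);
        now apply (Hold y n u' (or_intror eq_refl) Hu').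
    + intros u' Hu'. destruct (IH u' Hu') as [k' Hk']. exists k'. apply Hg'. left.
      apply Hg. split; [now apply (HT y) | exact Hk'].
Qed.

Lemma check_not_ur y n : check y n -> ~ ur n.
Proof. intros (g & Hg & H). apply (Hg _ _ H). Qed.

Lemma mem_check_ur y n : check y n -> ur y ->
  forall z, mem z n <-> is_pair z y (top P).
Proof. intros (g & Hg & H). apply (Hg _ _ H). Qed.

Lemma mem_check_set y n : check y n -> ~ ur y ->
  forall z, mem z n <-> exists y' n', mem y' y /\ check y' n' /\ is_pair z n' (top P).
Proof.
  intros (g & Hg & H) Hy z. destruct (Hg _ _ H) as (_ & _ & K).
  destruct (K Hy) as [K1 K2]. rewrite K1.
  split; intros (u & k & Hu & Hk & Hz); exists u, k; repeat split; auto.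
  - now exists g.
  - destruct (K2 u Hu) as [k' Hk']. replace k with k'; [exact Hk'|].
    apply (check_uniq u); [now exists g | exact Hk].
Qed.

Lemma pair_in_check_ur y n x p : check y n -> ur y ->
  (pair_in x p n <-> x = y /\ p = top P).
Proof.
  intros Hn Hy. destruct (pair_ex HM x p) as [z Hz].
  rewrite (pair_in_iff HM _ _ _ n Hz), (mem_check_ur y n Hn Hy).
  split; [exact (pair_inj _ _ _ _ _ Hz) | now intros [<- <-]].
Qed.

Lemma pair_in_check_set y n x p : check y n -> ~ ur y ->
  (pair_in x p n <-> (exists y', mem y' y /\ check y' x) /\ p = top P).
Proof.
  intros Hn Hy. destruct (pair_ex HM x p) as [z Hz].
  rewrite (pair_in_iff HM _ _ _ n Hz), (mem_check_set y n Hn Hy). split.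
  - intros (u & k & Hu & Hk & Hz').
    destruct (pair_inj _ _ _ _ _ Hz Hz') as [-> ->]. eauto.
  - intros [[u [Hu Hk]] ->]. now exists u, x.
Qed.

Lemma check_name y : forall n, check y n -> is_name P n.
Proof.
  apply (mem_ind HM (fun y => forall n, check y n -> is_name P n)).
  { unfold check, check_attempt. dfn. }
  clear y. intros y IH n Hn. apply (name_intro P HM).
  - exact (check_not_ur y n Hn).
  - intros z Hz. destruct (classic (ur y)) as [Hy|Hy].
    + apply (mem_check_ur y n Hn Hy) in Hz. exists y, (top P).
      split; [exact Hz|]. split; [apply top_in | now right].
    + apply (mem_check_set y n Hn Hy) in Hz as (u & k & Hu & Hk & Hz).
      exists k, (top P). split; [exact Hz|]. split; [apply top_in|].
      left. exact (IH u Hu k Hk).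
  - intros a p x q Ha Hap Hxq Hne. destruct (classic (ur y)) as [Hy|Hy].
    + apply (pair_in_check_ur y) in Hap, Hxq; auto.
      destruct Hap, Hxq. congruence.
    + apply (pair_in_check_set y) in Hap; auto.
      destruct Hap as [[u [_ Hk]] _]. destruct (check_not_ur u a Hk Ha).
Qed.

End CheckNames.

Ltac dfn_check := first [ dfn_forces | apply definable_check ].
Ltac dfn_hint ::= dfn_check.

(** * Evaluation of names at an atom *)

Fixpoint translate (f : sform) : fform :=
  match f with
  | s_mem i j => f_in i j
  | s_eq i j => f_eq i j
  | s_ur i => f_ur i
  | s_not f => f_not (translate f)
  | s_and f g => f_and (translate f) (translate g)
  | s_ex f => f_ex (translate f)
  end.

Section Atom.
Context {M : ustructure} (P : poset M).
Hypothesis HM : ZFCU_R M.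
Variable x : M.
Hypothesis x_in : mem x (carrier P).
Hypothesis x_min : forall q, ple P q x -> q = x.

Lemma dense_below_atom D : dense_below P D x <-> D x.
Proof.
  split.
  - intros H. destruct (H x (ple_refl P x x_in)) as [r [Hr HD]].
    now rewrite <- (x_min r Hr).
  - intros H. apply dense_below_all. intros q Hq. now rewrite (x_min q Hq).
Qed.

Lemma atom_le_top : ple P x (top P).
Proof. now apply top_max. Qed.

Lemma forces_check_in z n m : check P z m ->
  forces_in P x n m <->
  ~ ur z /\ exists y' k, mem y' z /\ check P y' k /\ forces_eq P x k n.
Proof.
  intros Hm. unfold forces_in, in_clause. rewrite dense_below_atom. split.
  - intros (k & r & Hk & Hkr & Hxr & E). destruct (classic (ur z)) as [Hz|Hz].
    + apply (pair_in_check_ur P HM z) in Hkr as [-> _]; auto.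
      destruct (name_not_ur P z Hk Hz).
    + apply (pair_in_check_set P HM z) in Hkr as [[y' Hy'] _]; auto.
      split; [exact Hz|]. exists y', k. tauto.
  - intros (Hz & y' & k & Hy' & Hk & E). exists k, (top P).
    split; [exact (check_name P HM y' k Hk)|].
    split; [apply (pair_in_check_set P HM z); eauto|].
    split; [exact atom_le_top | exact E].
Qed.

Lemma forces_ureq_check y z n m : check P y n -> check P z m ->
  forces_ureq P x n m -> ur y -> y = z.
Proof.
  intros Hn Hm H Hy. apply dense_below_atom in H
    as [(a & r1 & r2 & Ha & H1 & H2 & _)|[_ H]].
  - apply (pair_in_check_ur P HM y) in H1 as [-> _]; auto.
    destruct (classic (ur z)) as [Hz|Hz].
    + apply (pair_in_check_ur P HM z) in H2 as [-> _]; auto.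
    + apply (pair_in_check_set P HM z) in H2 as [[u [_ Hu]] _]; auto.
      destruct (check_not_ur P u y Hu Hy).
  - destruct (H y (top P) Hy).
    + left. now apply (pair_in_check_ur P HM y).
    + exists x. split; [now apply ple_refl | exact atom_le_top].
Qed.

(** Membership induction on [y]: forced inclusions between canonical names turn into actual
    inclusions once equality is known for the elements of [y]. *)
Lemma forces_eq_check y : forall z n m, check P y n -> check P z m ->
  forces_eq P x n m -> y = z.
Proof.
  apply (mem_ind HM (fun y => forall z n m, check P y n -> check P z m ->
    forces_eq P x n m -> y = z)); [dfn|].
  clear y. intros y IH z n m Hn Hm E.
  destruct (classic (ur y)) as [Hy|Hy].
  { apply (forces_ureq_check y z n m); auto. now apply forces_eq_ureq. }
  destruct (classic (ur z)) as [Hz|Hz].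
  { symmetry. apply (forces_ureq_check z y m n); auto.
    now apply forces_eq_ureq, forces_eq_sym. }
  (* Stated for arbitrary [u] and [w] to serve both inclusions. In the second one the element found
     in [y] is the one to which the induction hypothesis applies. *)
  assert (K : forall u w k l, check P u k -> ~ ur u -> check P w l ->
    forces_eq P x k l -> forall a, mem a u -> exists b c d,
      check P a c /\ check P b d /\ mem b w /\ forces_eq P x c d).
  { intros u w k l Hk Hu Hl F a Ha. destruct (check_ex P HM a) as [c Hc].
    assert (Hin : forces_in P x c l).
    { apply (forces_eq_sub P x k l F c (top P) x).
      - exact (check_name P HM a c Hc).
      - apply (pair_in_check_set P HM u); eauto.
      - now apply ple_refl.
      - exact atom_le_top. }
    apply (forces_check_in w) in Hin as (_ & b & d & Hb & Hd & G); [|exact Hl].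
    exists b, c, d. repeat (split; [assumption|]). now apply forces_eq_sym. }
  apply (set_ext HM); auto. intros a. split; intros Ha.
  - destruct (K y z n m Hn Hy Hm E a Ha) as (b & c & d & Hc & Hd & Hb & F).
    now rewrite (IH a Ha b c d Hc Hd F).
  - destruct (K z y m n Hm Hz Hn (forces_eq_sym P HM _ _ _ E) a Ha)
      as (b & c & d & Hc & Hd & Hb & F).
    now rewrite <- (IH b Hb a d c Hd Hc (forces_eq_sym P HM _ _ _ F)).
Qed.

(** This is evaluation of [n] by the filter of conditions above the atom. If an urelement is
    attached to such a condition, it is the value; otherwise the value is the set of values of the
    subnames attached to such conditions. Replacement collects these, as [forces_eq_check] makes
    values unique. *)
Lemma name_value n : is_name P n -> exists y k, check P y k /\ forces_eq P x n k.
Proof.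
  revert n.
  apply (name_ind P HM (fun n => exists y k, check P y k /\ forces_eq P x n k));
    [dfn|].
  intros n Hn IH.
  destruct (classic (exists a r, ur a /\ pair_in a r n /\ ple P x r))
    as [(a & r & Ha & Har & Hxr)|Hno].
  - destruct (check_ex P HM a) as [k Hk]. exists a, k. split; [exact Hk|].
    apply (forces_eq_intro P HM); auto; [exact (check_name P HM a k Hk)|].
    split; [|split].
    + intros m s q Hm Hms Hq Hqs. rewrite (x_min q Hq) in *.
      (* A subname active at the atom together with [a] would have to be [a] itself, which is no
         name. *)
      rewrite (name_ur_uniq P n a r m s x Hn Ha Har Hms Hxr Hqs) in Hm.
      destruct (name_not_ur P a Hm Ha).
    + intros m s q Hm Hms Hq Hqs.
      apply (pair_in_check_ur P HM a) in Hms as [-> _]; auto.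
      destruct (name_not_ur P a Hm Ha).
    + apply dense_below_atom. left. exists a, r, (top P).
      repeat (split; [assumption|]).
      split; [now apply (pair_in_check_ur P HM a) | split; [exact Hxr | exact atom_le_top]].
  - destruct (union2_ex HM n) as [U [_ HU]].
    destruct (sep HM (fun m => is_name P m /\ exists r, pair_in m r n /\ ple P x r) U)
      as [S [_ HS]]; [dfn|].
    assert (HS' : forall m, mem m S <->
      is_name P m /\ exists r, pair_in m r n /\ ple P x r).
    { intros m. rewrite HS. split; [tauto|]. intros H. split; [|exact H].
      destruct H as (_ & r & [z [Hz Hzn]] & _).
      destruct (pair_fst_mem _ _ _ Hz) as [u Hu]. apply HU. now exists z, u. }
    destruct (repl HM (fun m y => exists k, check P y k /\ forces_eq P x m k) S)
      as [Y [HuY HY]].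
    { dfn. }
    { intros m y y' _ (k & Hk & E) (k' & Hk' & E').
      apply (forces_eq_check y y' k k' Hk Hk').
      apply (forces_eq_trans P HM) with m; [now apply forces_eq_sym | exact E']. }
    destruct (check_ex P HM Y) as [k Hk]. exists Y, k. split; [exact Hk|].
    apply (forces_eq_intro P HM); auto; [exact (check_name P HM Y k Hk)|].
    split; [|split].
    + intros m r q Hm Hmr Hq Hqr. rewrite (x_min q Hq) in *.
      apply (forces_check_in Y m k Hk). split; [exact HuY|].
      destruct (IH m r Hmr Hm) as (y & c & Hc & E). exists y, c.
      split; [|split; [exact Hc | now apply forces_eq_sym]].
      apply HY. exists m. split; [|now exists c]. apply HS'.
      split; [exact Hm | now exists r].
    + intros m r q Hm Hmr Hq Hqr. rewrite (x_min q Hq) in *.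
      apply (pair_in_check_set P HM Y) in Hmr as [[y [Hy Hmy]] _]; auto.
      apply HY in Hy as (l & Hl & c & Hc & E).
      apply HS' in Hl as (Hl & s & Hls & Hxs).
      apply dense_below_atom. exists l, s. repeat (split; [assumption|]).
      now rewrite (check_uniq P HM y m c Hmy Hc).
    + apply dense_below_atom. right. split; [exact x_in|]. intros a r Ha [H|H].
      * intros [s [Hs Hsr]]. rewrite (x_min s Hs) in Hsr. apply Hno. now exists a, r.
      * apply (pair_in_check_set P HM Y) in H as [[u [_ Hu]] _]; auto.
        destruct (check_not_ur P u a Hu Ha).
Qed.

(** In the existential case an arbitrary witnessing name is replaced by the canonical name of its
    value, to which it is forced equal at the atom. *)
Lemma forces_translate f : forall e e', (forall i, check P (e i) (e' i)) ->
  (sat M f e <-> forces P x (translate f) e').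
Proof.
  induction f as [i j|i j|i|f IH|f IHf g IHg|f IH]; simpl; intros e e' He.
  - rewrite (forces_check_in (e j) (e' i) (e' j) (He j)). split.
    + intros H. split; [exact (not_ur_mem HM _ _ H)|].
      exists (e i), (e' i). split; [exact H|]. split; [apply He|].
      apply forces_eq_refl; auto. exact (check_name P HM _ _ (He i)).
    + intros (_ & y & k & Hy & Hk & E).
      now rewrite <- (forces_eq_check y (e i) k (e' i) Hk (He i) E).
  - split.
    + intros E. assert (H := He j). rewrite <- E in H.
      rewrite (check_uniq P HM (e i) (e' j) (e' i) H (He i)).
      apply forces_eq_refl; auto. exact (check_name P HM _ _ (He i)).
    + now apply forces_eq_check.
  - unfold forces_ur. rewrite dense_below_atom. split.
    + intros H. exists (e i), (top P). split; [exact H|].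
      split; [now apply (pair_in_check_ur P HM (e i)) | exact atom_le_top].
    + intros (a & r & Ha & Har & _). apply NNPP. intros H.
      apply (pair_in_check_set P HM (e i)) in Har as [[u [_ Hu]] _]; auto.
      destruct (check_not_ur P u a Hu Ha).
  - rewrite (IH e e' He). split.
    + intros H q Hq. now rewrite (x_min q Hq).
    + intros H. now apply H, ple_refl.
  - rewrite (IHf e e' He), (IHg e e' He). reflexivity.
  - rewrite dense_below_atom. split.
    + intros [y H]. destruct (check_ex P HM y) as [n Hn]. exists n.
      split; [exact (check_name P HM y n Hn)|]. revert H.
      apply IH. intros [|i]; simpl; auto.
    + intros (n & Hn & H). destruct (name_value n Hn) as (y & k & Hk & E).
      exists y. apply (IH (scons y e) (scons k e')).
      * intros [|i]; simpl; auto.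
      * revert H. apply (forces_congr P HM). intros [|i]; simpl; [exact E|].
        apply forces_eq_refl; auto. exact (check_name P HM _ _ (He i)).
Qed.

End Atom.

(** * Fullness implies Collection *)

(* The poset has the elements of [w] as pairwise incompatible atoms below the
   extra top element [w]. *)
Lemma antichain_poset (M : ustructure) (HM : ZFCU_R M) (w : M) :
  exists P : poset M,
    (forall z, mem z (carrier P) <-> mem z w \/ z = w) /\
    forall p q, ple P p q <->
      mem p (carrier P) /\ mem q (carrier P) /\ (p = q \/ q = w).
Proof.
  destruct (adjoin_ex HM w w) as (c & Hc & Kc).
  destruct (relset HM (fun p q => p = q \/ q = w) c c) as (o & Ho & Ko & Lo); [dfn|].
  assert (Hw : mem w c) by (apply Kc; tauto).
  unshelve eexists (@Poset M c o w Hc Ho _ _ _ _ Hw _).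
  - intros z Hz. destruct (Ko z Hz) as (p & q & H & Hp & Hq & _). now exists p, q.
  - intros p Hp. apply Lo. auto.
  - intros p q r H H'. apply Lo in H as (Hp & _ & H). apply Lo in H' as (_ & Hr & H').
    apply Lo. split; [exact Hp|]. split; [exact Hr|].
    destruct H as [-> | ->]; [exact H'|]. destruct H' as [H' | H']; auto.
  - intros p q H H'. apply Lo in H as (_ & _ & H). apply Lo in H' as (_ & _ & H').
    destruct H, H'; congruence.
  - intros p Hp. apply Lo. auto.
  - split; [exact Kc | exact Lo].
Qed.

Lemma fullness_collection (M : ustructure) (HM : ZFCU_R M) :
  Fullness M -> Collection M.
Proof.
  intros HF phi e w Hw.
  (* The existential is forced at the top only because atoms below it supply witnesses, so one atom
     [x0] is fixed; for empty [w] any set is a bound. *)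
  destruct (classic (exists x, mem x w)) as [[x0 Hx0]|Hempty].
  2:{ exists w. intros x Hx. destruct Hempty. now exists x. }
  destruct (antichain_poset M HM w) as (P & Hcar & Hple).
  assert (Hin : forall x, mem x w -> mem x (carrier P)) by (intros x Hx; apply Hcar; auto).
  (* By Foundation the top [w] is not among its own elements, so no atom coincides with it. *)
  assert (Hmin : forall x, mem x w -> forall q, ple P q x -> q = x).
  { intros x Hx q Hq. apply Hple in Hq as (_ & _ & [H|H]); [exact H|].
    subst x. destruct (mem_irrefl HM _ Hx). }
  (* The valuation [e] is external, so its canonical names are selected in the metatheory. *)
  destruct (functional_choice (fun i => check P (e i)) (fun i => check_ex P HM (e i)))
    as [e' He'].
  destruct (graph_ex HM (check P) w) as (g & _ & Hg); [dfn| |].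
  { intros x n n' _. apply (check_uniq P HM). }
  destruct (mixing P HM g) as (xdot & Hxn & Hx).
  { intros x n H. apply Hg in H as [Hx Hn].
    split; [auto | exact (check_name P HM x n Hn)]. }
  { intros x n x' n' r H H' Hr Hr'. apply Hg in H as [Hx Hn].
    apply Hg in H' as [Hx' Hn'].
    rewrite <- (Hmin x Hx r Hr) in Hn. rewrite <- (Hmin x' Hx' r Hr') in Hn'.
    exact (check_uniq P HM r n n' Hn Hn'). }
  assert (He'n : forall i, is_name P (e' i)).
  { intros i. exact (check_name P HM _ _ (He' i)). }
  (* The name [m] need only agree at the atom with the canonical name of [y]. This serves both for
     canonical witnesses and for the single name given by fullness. *)
  assert (truth : forall x y m k, mem x w -> check P y k -> forces_eq P x m k ->
    (sat M phi (scons y (scons x e)) <->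
     forces P x (translate phi) (scons m (scons xdot e')))).
  { intros x y m k Hxw Hk E. destruct (check_ex P HM x) as [n Hn].
    assert (Exn : forces_eq P x xdot n).
    { apply Hx, Hg. split; assumption. }
    rewrite (forces_translate P HM x (Hin x Hxw) (Hmin x Hxw) phi
      (scons y (scons x e)) (scons k (scons n e'))).
    2:{ intros [|[|i]]; simpl; auto. }
    split; apply (forces_congr P HM); intros [|[|i]]; simpl;
      try apply forces_eq_refl; auto using forces_eq_sym. }
  destruct (HF P (translate phi) (scons xdot e')) with (p := w) as (y & Hy & Hforce).
  - intros [|i]; simpl; auto.
  - apply Hcar. auto.
  - intros q Hq.
    (* The atom is [q] itself, or [x0] if [q] is the top. *)
    assert (Hq' : exists x, mem x w /\ ple P x q).
    { apply Hple in Hq as (Hq & _ & _). apply Hcar in Hq as H.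
      destruct H as [H| ->].
      - exists q. split; [exact H | now apply ple_refl].
      - exists x0. split; [exact Hx0|]. apply Hple. auto. }
    destruct Hq' as (x & Hxw & Hxq). exists x. split; [exact Hxq|].
    destruct (Hw x Hxw) as [y Hy]. destruct (check_ex P HM y) as [k Hk].
    assert (Hkn : is_name P k) by exact (check_name P HM y k Hk).
    exists k. split; [exact Hkn|]. apply (truth x y k k); auto.
    apply forces_eq_refl; auto.
  - destruct (repl HM (fun x y' => exists k, check P y' k /\ forces_eq P x y k) w)
      as (v & _ & Hv); [dfn| |].
    { intros x z z' Hxw (k & Hk & E) (k' & Hk' & E').
      apply (forces_eq_check P HM x (Hin x Hxw) (Hmin x Hxw) z z' k k' Hk Hk').
      apply (forces_eq_trans P HM) with y; [now apply forces_eq_sym | exact E']. }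
    exists v. intros x Hxw.
    destruct (name_value P HM x (Hin x Hxw) (Hmin x Hxw) y Hy) as (z & k & Hk & E).
    exists z. split.
    + apply Hv. exists x. split; [exact Hxw|]. now exists k.
    + apply (truth x z y k); auto. apply forces_le with w; [exact HM| |exact Hforce].
      apply Hple. split; [auto|]. split; [apply Hcar; auto | auto].
Qed.

Theorem theorem3p11 (M : ustructure) (HM : ZFCU_R M) :
  Collection M <-> Fullness M.
Proof.
  split; [now apply collection_fullness | now apply fullness_collection].
Qed.
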